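(* Let $C$ be a maximal cap in $AG(4,3)$ with anchor point $a$. For each unordered decomposition $C=D\cup D'$ of $C$ into two disjoint demicaps, let $\Phi(\{D,D'\})$ be the set of points $p\in AG(4,3)\setminus(C\cup\{a\})$ such that $p$ completes exactly one line with a pair of points of $D$ and exactly one line with a pair of points of $D'$. Then $\Phi(\{D,D'\})$ is a maximal cap, $\{C,\Phi(\{D,D'\})\}$ is a 1-completable pair, and $\Phi$ is a bijection from the set of $36$ unordered decompositions of $C$ into two disjoint demicaps onto the set of maximal caps $C'$ such that $\{C,C'\}$ is a 1-completable pair (of which there are $36$).
   Context: $AG(4,3)$ is the affine space $\mathbb{F}_3^4$; a line is a set of three distinct points $\{x,y,z\}$ with $x+y+z=0$. A cap is a set of points containing no line; a maximal cap is a cap of largest possible size (in $AG(4,3)$ this size is $20$); every maximal cap $C$ has a unique anchor point $a\notin C$ such that $C$ is a union of pairs $\{b,c\}$ with $\{a,b,c\}$ a line. A hyperplane is a $3$-dimensional affine subspace; a set of points is co-hyperplanar if it lies in a common hyperplane. For a point $a$, an $a$-line is a pair $\{b,c\}$ with $\{a,b,c\}$ a line. A demicap with anchor point $a$ is a cap consisting of the $10$ points of five $a$-lines such that no four of these five $a$-lines are co-hyperplanar. For a set $S$ and $p\notin S$, $p$ completes a line with a pair of points of $S$ if there are distinct $x,y\in S$ with $\{p,x,y\}$ a line; the number of lines $p$ completes with $S$ is the number of such unordered pairs. A partition (of the relevant kind) is a partition of $AG(4,3)$ into a singleton $\{a\}$ and four pairwise disjoint maximal caps each having anchor point $a$. Two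 disjoint maximal caps $C,C'$ form a $k$-completable pair if they occur together as blocks in exactly $k$ such partitions. *)

(* Defs.v *)
From HB Require Import structures.
From mathcomp Require Import all_boot all_order all_algebra.
Set Implicit Arguments. Unset Strict Implicit. Unset Printing Implicit Defensive.
Import GRing.Theory.
Local Open Scope ring_scope.

Definition pt : finType := 'rV['F_3]_4.

Definition is_line (x y z : pt) : bool :=
  [&& x != y, y != z, x != z & x + y + z == 0].

Definition cap (S : {set pt}) : bool :=
  [forall x in S, forall y in S, forall z in S, ~~ is_line x y z].

Definition maxcap (S : {set pt}) : bool :=
  cap S && [forall T : {set pt}, cap T ==> (#|T| <= #|S|)%N].

(* a is an anchor point of C: a \notin C and C is a union of a-lines
   (for b in C, the third point -(a+b) of the line through a and b is in C) *)
Definition anchor (a : pt) (C : {set pt}) : bool :=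
  (a \notin C) && [forall b in C, - (a + b) \in C].

Definition hyperplane (H : {set pt}) : bool :=
  [exists p : pt, exists V : 'M['F_3]_4,
     (\rank V == 3)%N && (H == [set x : pt | (x - p <= V)%MS])].

Definition cohyperplanar (S : {set pt}) : bool :=
  [exists H : {set pt}, hyperplane H && (S \subset H)].

(* demicap with anchor a: a cap consisting of the 10 points of five a-lines
   such that no four of these a-lines are co-hyperplanar (i.e. no union of
   four of them -- an 8-point a-line-closed subset -- lies in a hyperplane) *)
Definition demicap (a : pt) (D : {set pt}) : bool :=
  [&& cap D, #|D| == 10%N, anchor a D &
    [forall S : {set pt}, ((S \subset D) && anchor a S && (#|S| == 8%N))
                           ==> ~~ cohyperplanar S]].

Definition ncomplete (p : pt) (S : {set pt}) : nat :=
  #|[set P : {set pt} | (P \subset S) &&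
      [exists x : pt, exists y : pt,
         [&& x != y, P == [set x; y] & is_line p x y]]]|.

Definition good_partition (P : {set {set pt}}) : bool :=
  [exists a : pt,
    [&& [set a] \in P, #|P| == 5%N, partition P [set: pt] &
        [forall B in P, (B != [set a]) ==> (maxcap B && anchor a B)]]].

Definition completable (k : nat) (C C' : {set pt}) : bool :=
  [&& maxcap C, maxcap C', [disjoint C & C'] &
      #|[set P : {set {set pt}} | [&& good_partition P, C \in P & C' \in P]]| == k].

Definition decs (a : pt) (C : {set pt}) : {set {set {set pt}}} :=
  [set Q : {set {set pt}} | [exists D : {set pt}, exists D' : {set pt},
     [&& Q == [set D; D'], demicap a D, demicap a D', [disjoint D & D'] &
         D :|: D' == C]]].

Definition Phi (a : pt) (C : {set pt}) (Q : {set {set pt}}) : {set pt} :=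
  [set p : pt | [&& p \notin C, p != a &
      [forall D in Q, ncomplete p D == 1%N]]].

(* Main.v *)
(** A set with anchor point [a] has the form [a + {v, -v : v in S}], where [S] is
    a set of points of PG(3,3), and it is a cap of AG(4,3) exactly when [S] is a
    cap of PG(3,3).  A maximal cap [C] has at least 20 points, so [S] has at least
    10.  Four points of [S] are independent, since at most 14 points of [C] lie in
    the span of three of them.  In the basis that they form, an exhaustive search
    finds exactly 24 caps of PG(3,3) with at least ten points through the four
    basis points; all have ten points and are images of a single one, [C0], under
    monomial maps.  Hence [C] may be assumed to be the set given by [C0] in
    suitable coordinates.  A second search lists the 216 partitions of the other
    30 points of PG(3,3) into three caps of size 10.  The caps that occur in
    exactly one of these partitions are compared with the images under [Phi] of
    the 36 decompositions of [C0]. *)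
Require Import Defs.
From mathcomp Require Import all_boot all_order all_algebra.
Set Implicit Arguments. Unset Strict Implicit. Unset Printing Implicit Defensive.
Import GRing.Theory.

(** * Masks of points of PG(3,3) *)

(** The anchor is what makes the problem small enough to compute. Reflection in $a$ pairs the points
    of an anchored set, so one bit for each point of PG(3,3) determines the set, and every notion in
    the statement becomes a test on 40 bits. Since $3a=0$, a line inside the set is a relation $\pm
    u\pm v\pm w=0$ between three points of $S$. A hyperplane that contains an $a$-line passes
    through $a$, so the demicap condition only concerns linear functionals. A partition containing
    $C$ must use the anchor of $C$, because a second anchor would make $C$ invariant under a
    translation; hence all its large blocks are again given by masks. No bound on the size of caps
    is taken for granted. The lower bound 20 comes from exhibiting one cap, and the exact value from
    a search that would also report larger ones. The searches are only proved complete: what they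
    return is tested again by evaluation. *)

(* The field with three elements: [Some true] is 1 and [Some false] is -1.  The
   elements of ['F_3] carry proofs and reduce too slowly for the searches below. *)
Definition trit := option bool.
Definition addt (s t : trit) : trit :=
  match s, t with
  | None, u | u, None => u
  | Some true, Some true => Some false
  | Some false, Some false => Some true
  | _, _ => None
  end.
Definition oppt (t : trit) : trit := omap negb t.
Definition mult (s t : trit) : trit :=
  match s, t with
  | Some b, Some c => Some (b == c)
  | _, _ => None
  end.

Definition code := (trit * trit * trit * trit)%type.
Definition addc (c d : code) : code :=
  let: (c1, c2, c3, c4) := c in let: (d1, d2, d3, d4) := d in
  (addt c1 d1, addt c2 d2, addt c3 d3, addt c4 d4).
Definition oppc (c : code) : code :=
  let: (c1, c2, c3, c4) := c in (oppt c1, oppt c2, oppt c3, oppt c4).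
Definition scalec (t : trit) (c : code) : code :=
  let: (c1, c2, c3, c4) := c in (mult t c1, mult t c2, mult t c3, mult t c4).
Definition dotc (c d : code) : trit :=
  let: (c1, c2, c3, c4) := c in let: (d1, d2, d3, d4) := d in
  addt (addt (mult c1 d1) (mult c2 d2)) (addt (mult c3 d3) (mult c4 d4)).
Definition zeroc : code := (None, None, None, None).

Definition trits : seq trit := [:: None; Some true; Some false].
Definition codes : seq code :=
  [seq (u, t) | u <- [seq (u, t) | u <- [seq (s, t) | s <- trits, t <- trits], t <- trits],
              t <- trits].

Definition e1 : code := (Some true, None, None, None).
Definition e2 : code := (None, Some true, None, None).
Definition e3 : code := (None, None, Some true, None).
Definition e4 : code := (None, None, None, Some true).

Definition leading (c : code) : trit :=
  let: (c1, c2, c3, c4) := c in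
  if c1 is Some b then Some b else if c2 is Some b then Some b else
  if c3 is Some b then Some b else c4.

(* One code from each pair of opposite nonzero codes: the 40 points of PG(3,3).
   A mask is a list of 40 booleans that selects points by position in this list. *)
Definition points : seq code :=
  [:: e1; e2; e3; e4] ++
  [seq c <- codes | (leading c == Some true) && (c \notin [:: e1; e2; e3; e4])].

(** A dependency between three distinct points of PG(3,3) that are pairwise not collinear with zero
    involves signs only: up to a global sign the coefficient of [q] is 1, which leaves these four
    sums. *)
Definition noncollinear (q p x : code) : bool :=
  all (fun c => c != zeroc)
    [:: addc (addc q p) x; addc (addc q p) (oppc x);
        addc (addc q (oppc p)) x; addc (addc q (oppc p)) (oppc x)].

(* The entry for the point [p] of [l] tells, for every earlier point [q] and every
   later point [x], whether [x] may be added to a cap containing [q] and [p].  The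
   search consumes the table row by row and performs no lookups. *)
Fixpoint table (prev l : seq code) : seq (seq bitseq) :=
  if l is p :: l' then
    [seq [seq noncollinear q p x | x <- l'] | q <- prev] :: table (p :: prev) l'
  else [::].

Fixpoint mask_and (m1 m2 : bitseq) : bitseq :=
  match m1, m2 with
  | b1 :: m1', b2 :: m2' => (b1 && b2) :: mask_and m1' m2'
  | _, _ => [::]
  end.
Definition mask_not : bitseq -> bitseq := map negb.

(** [rows] and [ch] both list the earlier points latest first, so they can be consumed in parallel.
    Each chosen earlier point removes the later points on its line through the point just added. *)
Fixpoint restrict (rows : seq bitseq) (ch av : bitseq) : bitseq :=
  match rows, ch with
  | row :: rows', b :: ch' => restrict rows' ch' (if b then mask_and row av else av)
  | _, _ => av
  end.

(* [av] marks the available positions, [must] those that have to be selected, and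
   [ch] lists the choices made so far, latest first.  At least [n] more points are
   required: the truncated predecessor keeps the masks with extra points. *)
Fixpoint search (T : seq (seq bitseq)) (n : nat) (av must ch : bitseq) : seq bitseq :=
  match T, av, must with
  | rows :: T', b :: av', f :: must' =>
    if (count id av < n)%N then [::] else
    (if b then map (cons true) (search T' n.-1 (restrict rows ch av') must' (true :: ch))
     else [::]) ++
    (if f then [::] else map (cons false) (search T' n av' must' (false :: ch)))
  | _, _, _ => if n == 0 then [:: [::]] else [::]
  end.

Definition first (m : bitseq) : bitseq :=
  [seq j == find id m | j <- iota 0 40].

(* Forcing the first remaining point into [A], and then into [B], produces every
   unordered partition of [m] into three blocks once. *)
Definition splits (m : bitseq) : seq (seq bitseq) :=
  let T := table [::] points in
  flatten [seq let m' := mask_and m (mask_not A) in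
               [seq [:: A; B; mask_and m' (mask_not B)] |
                  B <- search T 10 m' (first m') [::]] |
             A <- search T 10 m (first m) [::]].

(** This is the elliptic quadric $x_1x_2=x_1x_3+x_1x_4+x_2x_3+x_2x_4+x_3x_4$; positions 0 to 3 are
    the basis points. *)
Definition C0 : bitseq :=
  [seq i \in [:: 0; 1; 2; 3; 9; 17; 24; 28; 36; 38] | i <- iota 0 40].

Definition point_index (c : code) : nat := find (fun p => (p == c) || (p == oppc c)) points.
Definition covers (m : bitseq) (c : code) : bool := nth false m (point_index c).

(* [ps] holds the points that precede [s]. *)
Fixpoint independent (ps s : seq code) : bool :=
  if s is p :: s' then
    all (fun x => all (fun q => noncollinear q p x) ps) s' && independent (p :: ps) s'
  else true.
Definition cap_mask (m : bitseq) : bool := independent [::] (mask m points).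

(* A conditional instead of [&&] because [vm_compute] is call-by-value and would
   evaluate the second conjunct as well. *)
Definition demicap_mask (m : bitseq) : bool :=
  let s := mask m points in
  if count id m == 5 then
    all (fun h => (h == zeroc) || (count (fun p => dotc h p == None) s < 4)%N) codes
  else false.

Fixpoint submasks (m : bitseq) : seq bitseq :=
  if m is b :: m' then
    (if b then map (cons true) (submasks m') else [::]) ++ map (cons false) (submasks m')
  else [:: [::]].

(** Requiring the first half to contain [e1] lists each unordered pair once. *)
Definition decompositions : seq (bitseq * bitseq) :=
  [seq p <- [seq (d, mask_and C0 (mask_not d)) | d <- submasks C0] |
     if covers p.1 e1 then demicap_mask p.1 && demicap_mask p.2 else false].

Definition signed (m : bitseq) : seq code :=
  let s := mask m points in s ++ map oppc s.

(* This counts ordered pairs, so it is twice the number of lines. *)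
Definition joins (m : bitseq) (c : code) : nat :=
  let s := signed m in count (fun u => oppc (addc c u) \in s) s.
Definition Phi_mask (d : bitseq * bitseq) : bitseq :=
  [seq [&& ~~ covers C0 c, joins d.1 c == 2 & joins d.2 c == 2] | c <- points].

Fixpoint eq_mask (m1 m2 : bitseq) : bool :=
  match m1, m2 with
  | [::], [::] => true
  | true :: m1', true :: m2' | false :: m1', false :: m2' => eq_mask m1' m2'
  | _, _ => false
  end.

Definition single_blocks (P : seq (seq bitseq)) : seq bitseq :=
  [seq m <- flatten P | count (fun t => has (eq_mask m) t) P == 1].

Definition monomials : seq (seq code) :=
  let B := flatten [seq [:: c; oppc c] | c <- [:: e1; e2; e3; e4]] in
  [seq t | t <- [seq [:: u.1.1; u.1.2; u.2.1; u.2.2] |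
       u <- [seq (v, w) | v <- [seq (c, d) | c <- B, d <- B],
                          w <- [seq (c, d) | c <- B, d <- B]]] &
     uniq [seq point_index c | c <- t]].

(** Partitions are sets of blocks, whereas splits are lists. This test excludes two lists that
    differ only in the order of their entries and would be counted as two partitions. *)
Definition injective_splits (P : seq (seq bitseq)) : bool :=
  all (fun t => all (fun t' =>
    if all (fun m => has (eq_mask m) t') t then all2 eq_mask t t' else true) P) P.

Definition well_split (t : seq bitseq) : bool :=
  (size t == 3) && uniq (C0 :: t) &&
  all (fun m => [&& size m == 40, count id m == 10 & cap_mask m]) t &&
  all (fun i => count (fun m => nth false m i) (C0 :: t) == 1) (iota 0 40).

Definition linear_code (g : seq code) (c : code) : code :=
  let: (c1, c2, c3, c4) := c in
  addc (addc (scalec c1 (nth zeroc g 0)) (scalec c2 (nth zeroc g 1)))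
       (addc (scalec c3 (nth zeroc g 2)) (scalec c4 (nth zeroc g 3))).

Definition frame_caps : seq bitseq :=
  search (table [::] points) 10 (nseq 40 true) (nseq 4 true ++ nseq 36 false) [::].

(** Inclusion of the image is enough, because the masks tested have ten points like [C0]. The second
    condition says that the kernel is trivial. *)
Definition image_of_C0 (m : bitseq) (g : seq code) : bool :=
  if all (fun p => covers m (linear_code g p)) (mask C0 points) then
    all (fun c => (c == zeroc) || (linear_code g c != zeroc)) codes
  else false.

(** Taking both lists as arguments lets one evaluation of the searches serve all the tests. The last
    two together make [Phi_mask] a bijection from the decompositions onto the masks that occur in
    exactly one split. *)
Definition check_splits (D : seq (bitseq * bitseq)) (P : seq (seq bitseq)) : bool :=
  [&& injective_splits P, uniq P, all well_split P, uniq (single_blocks P)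
    & perm_eq (map Phi_mask D) (single_blocks P)].

Lemma check_splits_C0 : check_splits decompositions (splits (mask_not C0)).
Proof. by vm_cast_no_check (erefl true). Qed.

(* Locking prevents conversion tests from unfolding the searches. *)
Definition all_splits : seq (seq bitseq) := locked (splits (mask_not C0)).
Definition all_decs : seq (bitseq * bitseq) := locked decompositions.

Lemma all_splits_check :
  [/\ injective_splits all_splits, uniq all_splits, all well_split all_splits,
    uniq (single_blocks all_splits) & perm_eq (map Phi_mask all_decs) (single_blocks all_splits)].
Proof.
apply/and5P; change (check_splits all_decs all_splits).
by rewrite /all_splits /all_decs -!lock check_splits_C0.
Qed.

Lemma size_all_decs : size all_decs = 36.
Proof. by rewrite /all_decs -lock; apply/eqP; vm_compute. Qed.

Lemma C0_check : (size C0 == 40) && (count id C0 == 10) && cap_mask C0 && covers C0 e1.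
Proof. by vm_cast_no_check (erefl true). Qed.

(* A second anchor [a + v] of the cap would make it invariant under translation
   by [v]. *)
Lemma C0_not_translated :
  all (fun c => (c == zeroc) || has (fun u => ~~ covers C0 (addc c u)) (signed C0)) codes.
Proof. by vm_cast_no_check (erefl true). Qed.

Lemma frame_check :
  all (fun m => (count id m == 10) && has (image_of_C0 m) monomials) frame_caps.
Proof. by vm_cast_no_check (erefl true). Qed.

Lemma points_e : [/\ nth zeroc points 0 = e1, nth zeroc points 1 = e2,
  nth zeroc points 2 = e3 & nth zeroc points 3 = e4].
Proof. by split; apply/eqP; vm_compute. Qed.

(** * Arithmetic of codes *)

Lemma addtC : commutative addt. Proof. by do 2![case=> [[]|]]. Qed.
Lemma addtA : associative addt. Proof. by do 3![case=> [[]|]]. Qed.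
Lemma addtN t : addt t (oppt t) = None. Proof. by case: t => [[]|]. Qed.

Lemma oppcK : involutive oppc.
Proof. by case=> [[[[[]|] [[]|]] [[]|]] [[]|]]. Qed.

Lemma addcC : commutative addc.
Proof. by move=> [[[? ?] ?] ?] [[[? ?] ?] ?] /=; congr (_, _, _, _); apply: addtC. Qed.

Lemma addcA : associative addc.
Proof. by move=> [[[? ?] ?] ?] [[[? ?] ?] ?] [[[? ?] ?] ?] /=; rewrite !addtA. Qed.

Lemma addc0 c : addc c zeroc = c.
Proof. by case: c => [[[[[]|] [[]|]] [[]|]] [[]|]]. Qed.

Lemma addcN c : addc c (oppc c) = zeroc.
Proof. by case: c => [[[? ?] ?] ?] /=; rewrite !addtN. Qed.

Lemma oppc_eq0 c : (oppc c == zeroc) = (c == zeroc).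
Proof. by case: c => [[[[[]|] [[]|]] [[]|]] [[]|]]. Qed.

Lemma mem_codes c : c \in codes.
Proof. by case: c => [[[[[]|] [[]|]] [[]|]] [[]|]]. Qed.

Lemma card_code : #|{: code}| = 81.
Proof. by rewrite !card_prod !card_option !card_bool. Qed.

Lemma swapt u v w :
  addt (addt u (oppt v)) w = oppt (addt (addt v (oppt u)) (oppt w)).
Proof. by case: u v w => [[]|] [[]|] [[]|]. Qed.

Lemma noncollinearC12 q p x : noncollinear q p x = noncollinear p q x.
Proof.
have swap u v w : (addc (addc u (oppc v)) w == zeroc)
                  = (addc (addc v (oppc u)) (oppc w) == zeroc).
  rewrite -[RHS]oppc_eq0; congr (_ == _).
  case: u v w => [[[? ?] ?] ?] [[[? ?] ?] ?] [[[? ?] ?] ?] /=.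
  by congr (_, _, _, _); apply: swapt.
rewrite /noncollinear /= (addcC q p) (swap q p x) -(swap p q x) !andbT.
by do 2!congr (_ && _); rewrite andbC.
Qed.

Lemma noncollinearC23 q p x : noncollinear q p x = noncollinear q x p.
Proof.
have swap u v : addc (addc q u) v = addc (addc q v) u.
  by rewrite -!addcA (addcC u).
rewrite /noncollinear /= (swap p x) (swap p (oppc x)) (swap (oppc p) x)
  (swap (oppc p) (oppc x)) !andbT.
by congr (_ && _); rewrite andbCA.
Qed.

(** * Completeness of the search *)

Definition submask (m1 m2 : bitseq) : Prop := forall i, nth false m1 i -> nth false m2 i.

Lemma submask_cons b1 m1 b2 m2 :
  submask (b1 :: m1) (b2 :: m2) -> (b1 -> b2) /\ submask m1 m2.
Proof. by move=> s; split=> [|i]; [apply: (s 0)|apply: (s i.+1)]. Qed.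

Lemma count_submask m1 m2 : submask m1 m2 -> (count id m1 <= count id m2)%N.
Proof.
elim: m1 m2 => [|b1 m1 IH] [|b2 m2] // s.
  by case: b1 s => [/(_ 0 isT)//|s]; apply: (IH [::]) => i; have := s i.+1; rewrite !nth_nil.
have [s0 s1] := submask_cons s; apply: leq_add (IH _ s1).
by case: b1 b2 s0 {s} => [] [] // /(_ isT).
Qed.

Lemma size_mask_and m1 m2 : size m1 = size m2 -> size (mask_and m1 m2) = size m1.
Proof. by elim: m1 m2 => [|b1 m1 IH] [|b2 m2] //= [/IH->]. Qed.

Lemma nth_mask_and m1 m2 i :
  nth false (mask_and m1 m2) i = nth false m1 i && nth false m2 i.
Proof.
by elim: m1 m2 i => [|b1 m1 IH] [|b2 m2] [|i] //=; rewrite ?nth_nil ?andbF.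
Qed.

Lemma nth_mask_not m i : (i < size m)%N -> nth false (mask_not m) i = ~~ nth false m i.
Proof. by move=> lti; rewrite (nth_map false). Qed.

Lemma nth_in_mask (T : eqType) (x0 : T) m (s : seq T) i :
  (i < size s)%N -> nth false m i -> nth x0 s i \in mask m s.
Proof.
elim: m s i => [|b m IH] [|x s] [|i] //= lti mi; rewrite ?nth_nil // in mi *.
  by rewrite mi mem_head.
by case: b; rewrite ?inE IH ?orbT.
Qed.

Lemma distinct_independent s :
  uniq s ->
  {in s & &, forall q p x, q != p -> p != x -> q != x -> noncollinear q p x} ->
  independent [::] s.
Proof.
have gen ps : uniq (ps ++ s) ->
  {in ps ++ s & &, forall q p x, q != p -> p != x -> q != x -> noncollinear q p x} ->
  independent ps s.
  elim: s ps => [|p s IH] ps //= U H; apply/andP; split.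
    apply/allP=> x xs; apply/allP=> q qps.
    move: U; rewrite cat_uniq /= => /and3P[_ Hh /andP[pns _]].
    apply: H; rewrite ?mem_cat ?inE ?qps ?eqxx ?xs ?orbT //.
    - by apply: contraNneq Hh => qp; rewrite -qp qps.
    - by apply: contraNneq pns => ->.
    by apply: contraNneq Hh => qx; apply/orP; right; apply/hasP; exists x => //; rewrite -qx.
  apply: IH; first by rewrite -(perm_uniq (permEl (perm_catCA [:: p] ps s))) in U *.
  have sb: {subset (p :: ps) ++ s <= ps ++ p :: s}.
    by move=> z; rewrite !(mem_cat, inE) orbCA orbA.
  by move=> q r x /sb ? /sb ? /sb ?; apply: H.
exact: (gen [::]).
Qed.

Lemma independent_noncollinear s : independent [::] s ->
  {in s & &, forall q p x, q != p -> p != x -> q != x -> noncollinear q p x}.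
Proof.
have gen ps : independent ps s ->
  {in ps, forall q, {in s &, forall p x, p != x -> noncollinear q p x}} /\
  {in s & &, forall q p x, q != p -> p != x -> q != x -> noncollinear q p x}.
  elim: s ps => [|y s IH] ps //= /andP[/allP gy /IH[H1 H2]].
  have Hy q p : q \in ps -> p \in s -> noncollinear q y p.
    by move=> qps /gy /allP; apply.
  have Hn p x : p \in s -> x \in s -> p != x -> noncollinear y p x.
    by apply: H1; rewrite mem_head.
  split=> [q qps p x|q p x].
    rewrite !inE => /predU1P[->|ps'] /predU1P[->|xs]; rewrite ?eqxx //.
    - by move=> _; apply: Hy.
    - by move=> _; rewrite noncollinearC23; apply: Hy.
    by apply: H1 => //; rewrite inE qps orbT.
  rewrite !inE => /predU1P[->|qs] /predU1P[->|ps'] /predU1P[->|xs]; rewrite ?eqxx //.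
  - by move=> _ px _; apply: Hn.
  - by move=> _ _ qx; rewrite noncollinearC12; apply: Hn.
  - by move=> qp _ _; rewrite noncollinearC23 noncollinearC12; apply: Hn.
  exact: H2.
by case/(gen [::]).
Qed.

Lemma size_restrict n rows ch av : all (fun r => size r == n) rows ->
  size av = n -> size (restrict rows ch av) = n.
Proof.
elim: rows ch av => [|r rows IH] [|[] ch] av //= /andP[/eqP sr /IH{}IH] sa.
  by apply: IH; rewrite size_mask_and ?sr.
exact: IH.
Qed.

Lemma submask_restrict p l prev ch av m :
  size m = size l -> submask m av ->
  all (fun x => all (fun q => noncollinear q p x) (mask ch prev)) (mask m l) ->
  submask m (restrict [seq [seq noncollinear q p x | x <- l] | q <- prev] ch av).
Proof.
move=> sm; elim: prev ch av => [|q prev IH] [|b ch] av //= sav.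
case: b => /= /allP H; last by apply: IH => //; apply/allP.
apply: IH; last by apply/allP=> x /H /andP[].
move=> i mi; rewrite nth_mask_and sav // andbT.
have lti : (i < size l)%N.
  by rewrite -sm ltnNge; apply: contraL mi => /(nth_default false)->.
by rewrite (nth_map zeroc) //; have /H/andP[] := nth_in_mask zeroc lti mi.
Qed.

(** The induction follows the table. The hypothesis on [mask ch prev] carries the points already
    chosen, so that every row applied by [restrict] keeps the target [m] available. *)
Lemma search_complete l prev ch n av must m :
  size m = size l -> size av = size l -> size must = size l ->
  submask m av -> submask must m -> (n <= count id m)%N ->
  independent (mask ch prev) (mask m l) ->
  m \in search (table prev l) n av must ch.
Proof.
elim: l prev ch n av must m => [|p l IH] prev ch n [|v av] [|f must] [|b m] //=.
  by move=> _ _ _ _ _; rewrite leqn0 => ->.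
move=> [sm] [sa] [sf] sav smust len g.
have [vb sav'] := submask_cons sav; have [fb smust'] := submask_cons smust.
have /= lec := count_submask sav.
rewrite ltnNge (leq_trans len lec) /= mem_cat.
case: b vb fb g len {lec sav smust} => /= [-> // _|_ fb] g len.
- apply/orP; left; rewrite mem_map; last by move=> ? ? [].
  have /andP[g1 g2] := g.
  apply: IH => //.
  + rewrite (@size_restrict (size l)) //.
    by apply/allP=> _ /mapP[q _ ->]; rewrite size_map.
  + exact: submask_restrict.
  by case: n len => //= n; rewrite add1n.
- apply/orP; right; case: f fb => [/(_ isT)//|_].
  rewrite mem_map; last by move=> ? ? [].
  exact: IH.
Qed.

Lemma oppcD c d : oppc (addc c d) = addc (oppc c) (oppc d).
Proof.
have oppt_add s t : oppt (addt s t) = addt (oppt s) (oppt t).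
  by case: s t => [[]|] [[]|].
by case: c d => [[[? ?] ?] ?] [[[? ?] ?] ?]; rewrite /= !oppt_add.
Qed.

(** * Positions of codes, and the signed points of a mask *)

Lemma size_points : size points = 40. Proof. by vm_compute. Qed.
Lemma uniq_points : uniq points. Proof. by vm_compute. Qed.
Lemma oppc_points p : p \in points -> oppc p \notin points.
Proof.
have /allP H: all (fun p => oppc p \notin points) points by vm_compute.
exact: H.
Qed.

Lemma point_index_oppc c : point_index (oppc c) = point_index c.
Proof. by apply: eq_find => p; rewrite oppcK orbC. Qed.

(** The position is out of range, so [covers] reads its default [false] there: the zero code, which
    stands for the anchor, belongs to no mask of size 40. *)
Lemma point_index0 : point_index zeroc = 40. Proof. by vm_compute. Qed.

Lemma point_index_nth i : i < 40 -> point_index (nth zeroc points i) = i.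
Proof.
have /allP H: all (fun i => point_index (nth zeroc points i) == i) (iota 0 40) by vm_compute.
by move=> lti; apply/eqP/H; rewrite mem_iota.
Qed.

Lemma point_index_lt c : c != zeroc -> point_index c < 40.
Proof.
have /allP H: all (fun c => (c != zeroc) ==> (point_index c < 40)) codes by vm_compute.
by apply/implyP/H/mem_codes.
Qed.

Lemma nth_point_index c : c != zeroc ->
  c = nth zeroc points (point_index c) \/ c = oppc (nth zeroc points (point_index c)).
Proof.
move=> /point_index_lt ltc.
have: has (fun p => (p == c) || (p == oppc c)) points by rewrite has_find size_points.
by case/(nth_find zeroc)/orP=> /eqP e; [left | right]; rewrite [nth _ _ _]e ?oppcK.
Qed.

Lemma covers_oppc m c : covers m (oppc c) = covers m c.
Proof. by rewrite /covers point_index_oppc. Qed.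

Lemma covers0 m : size m = 40 -> covers m zeroc = false.
Proof. by move=> sm; rewrite /covers point_index0 nth_default ?sm. Qed.

Lemma covers_nth m i : i < 40 -> covers m (nth zeroc points i) = nth false m i.
Proof. by move=> lti; rewrite /covers point_index_nth. Qed.

Lemma covers_and m1 m2 c : covers (mask_and m1 m2) c = covers m1 c && covers m2 c.
Proof. exact: nth_mask_and. Qed.

Lemma covers_not m c : size m = 40 -> c != zeroc -> covers (mask_not m) c = ~~ covers m c.
Proof. by move=> sm /point_index_lt ltc; rewrite /covers nth_mask_not ?sm. Qed.

Lemma mem_maskP (T : eqType) (x0 : T) m (s : seq T) x :
  x \in mask m s -> exists2 i, i < size s & nth false m i /\ x = nth x0 s i.
Proof.
elim: m s => [|b m IH] [|y s] //=.
have rec : x \in mask m s -> exists2 i, i < (size s).+1 &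
    nth false (b :: m) i /\ x = nth x0 (y :: s) i.
  by case/IH=> i lti [mi ->]; exists i.+1.
case: b rec => // rec; rewrite inE => /predU1P[->|/rec//].
by exists 0.
Qed.

Lemma in_mask_points m p : p \in mask m points -> p \in points /\ covers m p.
Proof.
case/(mem_maskP zeroc)=> i; rewrite size_points => lti [mi ->].
by rewrite covers_nth // mem_nth // size_points.
Qed.

Lemma mem_signed m c : size m = 40 -> (c \in signed m) = covers m c.
Proof.
move=> sm; apply/idP/idP.
  rewrite mem_cat => /orP[/in_mask_points[]//|/mapP[d /in_mask_points[_ md] ->]].
  by rewrite covers_oppc.
case: (eqVneq c zeroc) => [->|nz]; first by rewrite covers0.
rewrite /covers => mc; have := nth_in_mask zeroc (s := points) _ mc.
rewrite size_points => /(_ (point_index_lt nz)) inM; rewrite mem_cat.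
case: (nth_point_index nz) => ->; first by rewrite inM.
by apply/orP; right; rewrite map_f.
Qed.

Lemma uniq_signed m : uniq (signed m).
Proof.
rewrite cat_uniq map_inj_uniq ?mask_uniq ?uniq_points //; last exact: (can_inj oppcK).
rewrite andbT; apply/hasPn=> _ /mapP[p /in_mask_points[pp _] ->].
by apply: contra (oppc_points pp) => /in_mask_points[].
Qed.

Lemma size_signed m : size m = 40 -> size (signed m) = (count id m).*2.
Proof. by move=> sm; rewrite size_cat size_map size_mask ?size_points // addnn. Qed.

(** * Anchored sets in coordinates *)

Local Open Scope ring_scope.

Lemma pt_add3 (x : pt) : x + x + x = 0.
Proof.
rewrite -[x]scale1r -!scalerDl.
have -> : 1 + 1 + 1 = 0 :> 'F_3 by apply/val_inj.
by rewrite scale0r.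
Qed.

Lemma card_pt : #|{: pt}| = 81%N.
Proof. by rewrite card_mx card_Fp. Qed.

Definition scalt (t : trit) : 'F_3 :=
  match t with None => 0 | Some true => 1 | Some false => -1 end.
Definition unscalt (x : 'F_3) : trit := if x == 0 then None else Some (x == 1).

Lemma unscaltK : cancel unscalt scalt.
Proof. by case=> [[|[|[|n]]] lt //]; apply/val_inj. Qed.

Lemma scaltD s t : scalt (addt s t) = scalt s + scalt t.
Proof. by case: s t => [[]|] [[]|]; apply/val_inj. Qed.

Lemma scaltM s t : scalt (mult s t) = scalt s * scalt t.
Proof. by case: s t => [[]|] [[]|]; apply/val_inj. Qed.

Lemma scalt_dotc h1 h2 h3 h4 c1 c2 c3 c4 :
  scalt (dotc (h1, h2, h3, h4) (c1, c2, c3, c4)) =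
  scalt h1 * scalt c1 + scalt h2 * scalt c2 + (scalt h3 * scalt c3 + scalt h4 * scalt c4).
Proof. by rewrite -!scaltM -!scaltD. Qed.

Lemma dotc_oppc h c : (dotc h (oppc c) == None) = (dotc h c == None).
Proof.
have addt_opp s t : addt (oppt s) (oppt t) = oppt (addt s t).
  by case: s t => [[]|] [[]|].
have mult_opp s t : mult s (oppt t) = oppt (mult s t).
  by case: s t => [[]|] [[]|].
case: h c => [[[h1 h2] h3] h4] [[[c1 c2] c3] c4].
by rewrite /= !mult_opp !addt_opp; case: addt => [[]|].
Qed.

Lemma rank_col_nz (F : fieldType) n (w : 'cV[F]_n) : w != 0 -> \rank w = 1%N.
Proof.
by move=> nz; apply/eqP; rewrite eqn_leq rank_leq_col lt0n mxrank_eq0.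
Qed.

(** Any nonzero column of the cokernel matrix annihilates [V], and its kernel also has rank 3. *)
Lemma rank3_kernel (V : 'M['F_3]_4) : \rank V = 3%N ->
  exists2 w : 'cV_4, w != 0 & (V :=: kermx w)%MS.
Proof.
move=> rV; have : cokermx V != 0 by rewrite -mxrank_eq0 mxrank_coker rV.
have [/forallP z|/forallPn[j nz] _] := boolP [forall j, col j (cokermx V) == 0].
  case/eqP; apply/matrixP=> i j; have /eqP/matrixP/(_ i 0) := z j.
  by rewrite !mxE.
exists (col j (cokermx V)) => //; apply/eqmxP.
have sub : (V <= kermx (col j (cokermx V)))%MS.
  by apply/sub_kermxP; rewrite colE mulmxA mulmx_coker mul0mx.
by rewrite sub /= -(mxrank_leqif_sup sub).2 mxrank_ker (rank_col_nz nz) rV.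
Qed.

Opaque points codes.

Section Coordinates.

Variables (a : pt) (vec : code -> pt).
Hypothesis vecD : {morph vec : c d / addc c d >-> c + d}.
Hypothesis vec_inj : injective vec.

Lemma vec0 : vec zeroc = 0.
Proof. by apply: (addrI (vec zeroc)); rewrite -vecD addr0. Qed.

Lemma vecN c : vec (oppc c) = - vec c.
Proof. by apply: (addrI (vec c)); rewrite -vecD addcN vec0 subrr. Qed.

Lemma vec_surj (x : pt) : exists c, x = a + vec c.
Proof.
have inj: injective (fun c => a + vec c) by move=> c d /addrI/vec_inj.
have /codomP[c ->] : x \in codom (fun c => a + vec c).
  by apply: inj_card_onto => //; rewrite card_pt card_code.
by exists c.
Qed.

Definition spread (m : bitseq) : {set pt} := [set a + vec c | c in covers m].

Lemma mem_spread m c : (a + vec c \in spread m) = covers m c.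
Proof.
have inj: injective (fun c => a + vec c) by move=> ? ? /addrI/vec_inj.
exact: (mem_imset (covers m) c inj).
Qed.

Lemma card_spread m : size m = 40%N -> #|spread m| = (count id m).*2.
Proof.
move=> sm; rewrite card_imset => [|? ? /addrI/vec_inj//].
rewrite -size_signed // -(card_uniqP (uniq_signed m)).
by apply: eq_card => c; rewrite mem_signed.
Qed.

(** In coordinates centred at [a], being anchored is thus closure under negation. *)
Lemma third_point (u : pt) : - (a + (a + u)) = a - u.
Proof.
by apply/eqP; rewrite -subr_eq0 -opprD oppr_eq0 addrACA addrK pt_add3.
Qed.

Lemma anchor_spread m : size m = 40%N -> anchor a (spread m).
Proof.
move=> sm; apply/andP; split; first by rewrite -[a]addr0 -vec0 mem_spread covers0.
by apply/forall_inP=> _ /imsetP[c mc ->]; rewrite third_point -vecN mem_spread covers_oppc.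
Qed.

Definition mask_of (S : {set pt}) : bitseq := [seq a + vec p \in S | p <- points].

Lemma size_mask_of S : size (mask_of S) = 40%N.
Proof. by rewrite size_map size_points. Qed.

Lemma anchorN S c : anchor a S -> (a + vec (oppc c) \in S) = (a + vec c \in S).
Proof.
have half d : anchor a S -> a + vec d \in S -> a + vec (oppc d) \in S.
  by case/andP=> _ /forall_inP H /H; rewrite third_point -vecN.
by move=> aS; apply/idP/idP=> /half -/(_ aS) //; rewrite oppcK.
Qed.

Lemma covers_mask_of S c : anchor a S -> covers (mask_of S) c = (a + vec c \in S).
Proof.
move=> aS; case: (eqVneq c zeroc) => [->|nz].
  by rewrite covers0 ?size_mask_of // vec0 addr0; case/andP: aS => /negPf->.
rewrite /covers (nth_map zeroc) ?size_points ?point_index_lt //.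
by case: (nth_point_index nz) => {2}->; rewrite ?anchorN.
Qed.

Lemma spread_mask_of S : anchor a S -> spread (mask_of S) = S.
Proof.
move=> aS; apply/setP=> x; have [c ->] := vec_surj x.
by rewrite mem_spread covers_mask_of.
Qed.

Lemma spread_inj m1 m2 : size m1 = 40%N -> size m2 = 40%N ->
  spread m1 = spread m2 -> m1 = m2.
Proof.
move=> s1 s2 e; apply: (@eq_from_nth _ false); first by rewrite s1.
by move=> i; rewrite s1 => lti; rewrite -!covers_nth // -!mem_spread e.
Qed.

Lemma cap_codesP (S : {set pt}) : reflect
  (forall u v w, a + vec u \in S -> a + vec v \in S -> a + vec w \in S ->
     u != v -> v != w -> u != w -> addc (addc u v) w != zeroc) (cap S).
Proof.
have inj c d : (a + vec c == a + vec d) = (c == d).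
  by rewrite (inj_eq (addrI _)) (inj_eq vec_inj).
have sum u v w : (a + vec u + (a + vec v) + (a + vec w) == 0)
                 = (addc (addc u v) w == zeroc).
  by rewrite -(inj_eq vec_inj) vec0 !vecD [a + vec u + _]addrACA (addrACA (a + a)) pt_add3 add0r.
apply: (iffP idP) => [/forall_inP H u v w uS vS wS uv vw uw|H].
  have /forall_inP/(_ _ vS)/forall_inP/(_ _ wS) := H _ uS.
  by rewrite /is_line !inj uv vw uw sum.
apply/forall_inP=> x; have [u ->] := vec_surj x => uS.
apply/forall_inP=> y; have [v ->] := vec_surj y => vS.
apply/forall_inP=> z; have [w ->] := vec_surj z => wS.
by rewrite /is_line !inj sum; apply/and4P=> -[uv vw uw]; apply/negP/H.
Qed.

(** Since [points] has one code from each opposite pair, distinct points stay distinct under all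
    choices of sign, and each sum in [noncollinear] is an instance of the cap condition. Conversely,
    if two of three distinct codes with sum zero represent the same point, they are opposite and the
    third is zero, which no mask covers. *)
Lemma cap_spread m : size m = 40%N -> cap (spread m) = cap_mask m.
Proof.
move=> sm; apply/cap_codesP/idP=> [H|/independent_noncollinear H u v w].
  apply: distinct_independent => [|q p x]; first by rewrite (mask_uniq uniq_points).
  move=> /in_mask_points[qP qm] /in_mask_points[pP pm] /in_mask_points[xP xm] qp px qx.
  have neqN c d : c \in points -> d \in points -> c != oppc d.
    by move=> cP /oppc_points; apply: contraNneq => <-.
  have neqN' c d : c \in points -> d \in points -> oppc c != d.
    by move=> cP dP; rewrite eq_sym neqN.
  have neqNN c d : c != d -> oppc c != oppc d.
    by rewrite (inj_eq (can_inj oppcK)).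
  by rewrite /noncollinear /= !H ?mem_spread ?covers_oppc ?neqNN ?neqN ?neqN'.
rewrite !mem_spread => mu mv mw uv vw uw.
have rep c : covers m c -> exists2 p, p \in mask m points & c = p \/ c = oppc p.
  rewrite -mem_signed // mem_cat => /orP[cs|/mapP[p ps ->]]; first by exists c; [|left].
  by exists p; [|right].
have opp c d r s : c = r \/ c = oppc r -> d = s \/ d = oppc s -> c != d ->
    r = s -> d = oppc c.
  by move=> [->|->] [->|->] ne e; move: ne; rewrite e ?eqxx ?oppcK.
have nz c : covers m c -> c <> zeroc by move=> + e; rewrite e covers0.
have /rep[q qs eu] := mu; have /rep[p ps ev] := mv; have /rep[x xs ew] := mw.
apply/eqP=> s0.
have qp : q != p.
  apply/eqP=> /(opp _ _ _ _ eu ev uv) e; apply: (nz _ mw).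
  by rewrite -s0 e addcN addcC addc0.
have px : p != x.
  apply/eqP=> /(opp _ _ _ _ ev ew vw) e; apply: (nz _ mu).
  by rewrite -s0 e -addcA addcN addc0.
have qx : q != x.
  apply/eqP=> /(opp _ _ _ _ eu ew uw) e; apply: (nz _ mv).
  by rewrite -s0 e (addcC u) -addcA addcN addc0.
have /and5P[] := H _ _ _ qs ps xs qp px qx.
(* [noncollinear] fixes the sign of its first point, so the cases with $u=-q$ use the negated
   relation. *)
have s0' : oppc (addc (addc u v) w) = zeroc by rewrite s0.
move: s0 s0'; rewrite !oppcD.
by case: eu ev ew => -> [] -> [] ->; rewrite ?oppcK => s0 s0'; rewrite ?s0 ?s0'.
Qed.

(** An endpoint $x$ determines its partner $-(p+x)$, so the pairs that complete a line with $p$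
    partition the set [X] of their endpoints into blocks of size two; [joins] counts [X]. *)
Lemma ncomplete_spread d c : size d = 40%N -> ~~ covers d c ->
  (ncomplete (a + vec c) (spread d)).*2 = joins d c.
Proof.
move=> sd dc; set p := a + vec c; set D := spread d.
have pD x : x \in D -> p != x.
  by apply: contraTneq => <-; rewrite mem_spread.
pose X := [set x in D | - (p + x) \in D].
have lineE x y : is_line p x y -> y = - (p + x).
  by move=> /and4P[_ _ _]; rewrite addr_eq0 => /eqP->; rewrite opprK.
rewrite /ncomplete; set F := [set P | _].
have FP P x : P \in F -> x \in P -> x \in X /\ P = [set x; - (p + x)].
  rewrite inE => /andP[sPD /existsP[u /existsP[v /and3P[uv /eqP eP l]]]].
  move: sPD; rewrite eP => /subsetP sD.
  have uD : u \in D by rewrite sD ?set21.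
  have vD : v \in D by rewrite sD ?set22.
  have ev := lineE _ _ l.
  have eu : u = - (p + v) by rewrite ev opprD opprK addKr.
  rewrite !inE => /orP[]/eqP->; first by rewrite -ev uD vD.
  by rewrite -eu uD vD setUC.
have partF : partition F X.
  apply/and3P; split.
  - apply/eqP/setP=> x; apply/bigcupP/idP=> [[P PF /(FP _ _ PF)[]//]|xX].
    exists [set x; - (p + x)]; last exact: set21.
    move: (xX); rewrite inE => /andP[xD yD].
    rewrite inE subUset !sub1set xD yD; apply/existsP; exists x; apply/existsP.
    (* Equality would give $p=-2x=x$, but $p$ lies outside [D]. *)
    have ne : x != - (p + x).
      apply: contraTneq (pD x xD) => e; rewrite negbK -(inj_eq (addIr (x + x))).
      by rewrite !addrA pt_add3 addr_eq0 -[p + x]opprK -e.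
    by exists (- (p + x)); rewrite ne eqxx /is_line !pD // ne subrr eqxx.
  - apply/trivIsetP=> P Q PF QF; apply: contraR; rewrite -setI_eq0 => /set0Pn[x].
    by rewrite inE => /andP[/(FP _ _ PF)[_ ->] /(FP _ _ QF)[_ ->]].
  - apply/negP=> /[dup] F0; rewrite inE => /andP[_ /existsP[u /existsP[v]]].
    by case/and3P=> _ /eqP/setP/(_ u); rewrite !inE eqxx.
have F2 P : P \in F -> #|P| = 2%N.
  rewrite inE => /andP[_ /existsP[u /existsP[v /and3P[uv /eqP-> _]]]].
  by rewrite cards2 uv.
rewrite -muln2 -(card_uniform_partition F2 partF).
have third u : - (p + (a + vec u)) = a + vec (oppc (addc c u)).
  by rewrite -addrA (addrCA (vec c)) third_point vecN vecD.
have -> : X = [set a + vec u | u in [pred u | covers d u && covers d (oppc (addc c u))]].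
  apply/setP=> x; have [u ->] := vec_surj x; rewrite inE third !mem_spread.
  have inj: injective (fun c => a + vec c) by move=> ? ? /addrI/vec_inj.
  by rewrite (mem_imset _ u inj).
rewrite card_imset => [|? ? /addrI/vec_inj//].
rewrite /joins -size_filter -(card_uniqP (filter_uniq _ (uniq_signed d))).
apply: eq_card => u; rewrite unfold_in mem_filter !(mem_signed _ sd).
exact: andbC.
Qed.

(** * Linear functionals, hyperplanes through the anchor, and demicaps *)

Lemma vecZ t c : vec (scalec t c) = scalt t *: vec c.
Proof.
case: t => [[]|] /=; rewrite ?scale1r ?scale0r ?scaleN1r -?vecN -?vec0;
  by congr vec; case: c => [[[[[]|] [[]|]] [[]|]] [[]|]].
Qed.

Lemma vec_coords c1 c2 c3 c4 : vec (c1, c2, c3, c4) =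
  scalt c1 *: vec e1 + scalt c2 *: vec e2 + (scalt c3 *: vec e3 + scalt c4 *: vec e4).
Proof.
rewrite -!vecZ -!vecD; congr vec.
by case: c1 c2 c3 c4 => [[]|] [[]|] [[]|] [[]|].
Qed.

Definition pairing (w : 'cV['F_3]_4) (c : code) : 'F_3 := (vec c *m w) 0 0.

Lemma pairing_coords w c1 c2 c3 c4 : pairing w (c1, c2, c3, c4) =
  scalt c1 * pairing w e1 + scalt c2 * pairing w e2 +
  (scalt c3 * pairing w e3 + scalt c4 * pairing w e4).
Proof.
rewrite {1}/pairing vec_coords !mulmxDl -!scalemxAl.
by rewrite [LHS]mxE; congr (_ + _); rewrite [LHS]mxE; congr (_ + _); apply: mxE.
Qed.

(** A functional is determined by its values on the four basis codes. It thereby becomes a code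
    itself, so that running through [codes] runs through all functionals. *)
Definition covec (w : 'cV['F_3]_4) : code :=
  (unscalt (pairing w e1), unscalt (pairing w e2),
   unscalt (pairing w e3), unscalt (pairing w e4)).

Lemma pairing_covec w c : pairing w c = scalt (dotc (covec w) c).
Proof.
case: c => [[[c1 c2] c3] c4]; rewrite pairing_coords scalt_dotc.
move: (pairing w e1) (pairing w e2) (pairing w e3) (pairing w e4) => x1 x2 x3 x4.
by rewrite (unscaltK x1) (unscaltK x2) (unscaltK x3) (unscaltK x4) !(mulrC (scalt _)).
Qed.

Lemma vec_mul_eq0 w c : (vec c *m w == 0) = (dotc (covec w) c == None).
Proof.
have -> : (vec c *m w == 0) = (pairing w c == 0).
  apply/eqP/eqP => [|e]; first by rewrite /pairing => ->; rewrite mxE.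
  by apply/matrixP=> i j; rewrite !ord1 [RHS]mxE.
by rewrite pairing_covec; case: dotc => [[]|].
Qed.

Lemma covec_inj : injective covec.
Proof.
move=> w w' e; have eqw c : vec c *m w = vec c *m w'.
  apply/matrixP=> i j; rewrite !ord1.
  by have := pairing_covec w c; rewrite e -pairing_covec.
apply/row_matrixP=> i; rewrite !rowE.
have [c] := vec_surj (a + delta_mx 0 i); move/addrI=> ->; exact: eqw.
Qed.

Lemma covec0 : covec 0 = zeroc.
Proof. by rewrite /covec /pairing !mulmx0 mxE. Qed.

(** [covec] is onto, being injective between two sets of 81 elements. *)
Lemma functional_hyperplane h : h != zeroc ->
  exists2 H, hyperplane H & forall c, (a + vec c \in H) = (dotc h c == None).
Proof.
move=> nz; have /codomP[w ew] : h \in codom covec.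
  by apply: inj_card_onto; [exact: covec_inj | rewrite card_code card_mx card_Fp].
have wnz : w != 0 by apply: contraNneq nz => w0; rewrite ew w0 covec0.
exists [set x | (x - a <= kermx w)%MS] => [|c].
  apply/existsP; exists a; apply/existsP; exists (kermx w).
  by rewrite eqxx andbT mxrank_ker (rank_col_nz wnz).
rewrite inE addrC addKr ew -vec_mul_eq0; exact/sub_kermxP/eqP.
Qed.

Lemma hyperplane_functional H : hyperplane H -> a \in H ->
  exists2 h, h != zeroc & forall c, (a + vec c \in H) = (dotc h c == None).
Proof.
case/existsP=> p /existsP[V /andP[/eqP rV /eqP->]]; rewrite inE => aV.
have [w wnz kerw] := rank3_kernel rV.
exists (covec w) => [|c].
  by apply: contraNneq wnz; rewrite -covec0 => /covec_inj->.
have kerP (u : pt) : (u <= V)%MS = (u *m w == 0) by rewrite kerw; apply/sub_kermxP/eqP.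
rewrite inE addrAC kerP mulmxDl; move: aV; rewrite kerP => /eqP->.
by rewrite add0r vec_mul_eq0.
Qed.

(** For $x=a+v$ and $y=a-v$ in [S], one has $(x-p)+(y-p)=2(a-p)=-(a-p)$. *)
Lemma hyperplane_anchor H S : hyperplane H -> anchor a S -> S \subset H -> S != set0 ->
  a \in H.
Proof.
case/existsP=> p /existsP[V /andP[/eqP rV /eqP->]] aS /subsetP SH /set0Pn[x].
have [c ->] := vec_surj x => cS; move: (cS); rewrite -anchorN //.
move: cS => /SH + /SH; rewrite !inE vecN => xV yV.
have -> : a - p = - ((a + vec c - p) + (a - vec c - p)).
  rewrite (addrAC a (vec c)) (addrAC a (- vec c)); move: (a - p) => q.
  by rewrite addrACA subrr addr0; apply/eqP; rewrite -addr_eq0 addrA pt_add3.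
by rewrite eqmx_opp addmx_sub.
Qed.

Definition select (T : seq code) : bitseq := [seq p \in T | p <- points].

Lemma size_select T : size (select T) = 40%N.
Proof. by rewrite size_map size_points. Qed.

Lemma mem_select T p : p \in mask (select T) points -> p \in T.
Proof. by rewrite /select -filter_mask mem_filter => /andP[]. Qed.

Lemma count_select T : uniq T -> {subset T <= points} -> count id (select T) = size T.
Proof.
move=> uT sub; rewrite count_map -size_filter; apply: perm_size.
rewrite uniq_perm ?filter_uniq ?uniq_points // => p.
by rewrite mem_filter; apply/andb_idr => /sub.
Qed.

(** An anchored subset with eight points is the spread of four points, and a hyperplane containing
    it passes through [a]. It therefore lies in a hyperplane exactly when some nonzero functional
    vanishes at the four points. *)
Lemma demicap_spread d : size d = 40%N -> cap (spread d) -> demicap a (spread d) = demicap_mask d.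
Proof.
move=> sd capd; rewrite /demicap capd anchor_spread // card_spread // /demicap_mask.
rewrite -[10%N]/(5%N.*2) (inj_eq double_inj) andTb.
case: (count id d =P 5%N) => // c5; rewrite !andTb.
apply/forallP/allP=> [H h _|H S].
  rewrite -implyNb; apply/implyP=> nz; rewrite ltnNge; apply/negP=> ge4.
  have [T [uT T4 Ts]] : exists T, [/\ uniq T, size T = 4%N &
      forall p, p \in T -> [/\ p \in points, covers d p & dotc h p == None]].
    (* The functional may vanish at more than four points, but [demicap] speaks of exactly eight
       points of the set. *)
    exists (take 4 [seq p <- mask d points | dotc h p == None]); split=> [||p /mem_take].
    - by rewrite take_uniq // filter_uniq // (mask_uniq uniq_points).
    - by rewrite size_takel // size_filter.
    by rewrite mem_filter => /andP[dp /in_mask_points[]].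
  have sT := size_select T.
  have selT c : covers (select T) c -> covers d c /\ dotc h c == None.
    rewrite -(mem_signed _ sT) mem_cat => /orP[|/mapP[p + ->]].
      by case/mem_select/Ts.
    by rewrite covers_oppc dotc_oppc => /mem_select/Ts[].
  have cT : count id (select T) = 4%N.
    by rewrite count_select // => p /Ts[].
  have [K hK KE] := functional_hyperplane nz.
  have /implyP := H (spread (select T)).
  rewrite (anchor_spread sT) (card_spread sT) cT eqxx andbT => H'.
  have sub : spread (select T) \subset spread d.
    apply/subsetP=> x; have [c ->] := vec_surj x.
    by rewrite !mem_spread => /selT[].
  have /negP[] := H' (introT andP (conj sub isT)).
  apply/existsP; exists K; rewrite hK; apply/subsetP=> x; have [c ->] := vec_surj x.
  by rewrite mem_spread KE => /selT[].
apply/implyP=> /andP[/andP[sub aS] /eqP S8]; apply/negP=> /existsP[K /andP[hK SK]].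
have S0 : S != set0 by apply: contra_eq_neq S8 => ->; rewrite cards0.
have [h nz hE] := hyperplane_functional hK (hyperplane_anchor hK aS SK S0).
have := H h (mem_codes h); rewrite (negPf nz) orFb ltnNge => /negP[].
have sm := size_mask_of S; have eS := spread_mask_of aS.
have <- : count id (mask_of S) = 4%N.
  by apply: double_inj; rewrite -(card_spread sm) eS.
rewrite -(size_mask (s := points)) ?size_points // -size_filter.
apply: uniq_leq_size => [|p pS]; first by rewrite mask_uniq ?uniq_points.
have [pP] := in_mask_points pS; rewrite covers_mask_of // => aps.
rewrite mem_filter -hE (subsetP SK) //=.
have : covers d p by rewrite -mem_spread (subsetP sub).
rewrite -(mem_signed _ sd) mem_cat => /orP[//|/mapP[q /in_mask_points[qP _] e]].
by move: (oppc_points qP); rewrite -e pP.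
Qed.

End Coordinates.

Local Close Scope ring_scope.

(** * Decompositions and partitions of a cap in normal position *)

Lemma size_C0 : size C0 = 40. Proof. by case/andP: C0_check => /andP[/andP[/eqP]]. Qed.
Lemma count_C0 : count id C0 = 10. Proof. by case/andP: C0_check => /andP[/andP[_ /eqP]]. Qed.
Lemma cap_mask_C0 : cap_mask C0. Proof. by case/andP: C0_check => /andP[/andP[_ _]]. Qed.
Lemma C0_e1 : covers C0 e1. Proof. by case/andP: C0_check. Qed.

Lemma mem_splits r A B :
  A \in search (table [::] points) 10 r (first r) [::] ->
  let r' := mask_and r (mask_not A) in
  B \in search (table [::] points) 10 r' (first r') [::] ->
  [:: A; B; mask_and r' (mask_not B)] \in splits r.
Proof.
move=> AP r' BP; apply/flatten_mapP; exists A => //.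
by apply/mapP; exists B.
Qed.

Opaque C0 splits.

Lemma all_splitsP t : t \in all_splits ->
  [/\ size t = 3, uniq (C0 :: t),
    {in C0 :: t, forall m, [/\ size m = 40, count id m = 10 & cap_mask m]} &
    forall i, i < 40 -> count (fun m => nth false m i) (C0 :: t) = 1].
Proof.
have [_ _ /allP H _ _] := all_splits_check => /H.
case/andP=> /andP[/andP[/eqP s3 u] /allP h] /allP c.
split=> // [m|i lti]; last by apply/eqP/c; rewrite mem_iota.
rewrite inE => /predU1P[->|/h/and3P[/eqP-> /eqP-> ->] //].
by rewrite size_C0 count_C0 cap_mask_C0.
Qed.

Lemma eq_maskE : eq_mask =2 eq_op.
Proof. by elim=> [|[] m1 IH] [|[] m2] //=; rewrite IH. Qed.

Lemma has_eq_mask m t : has (eq_mask m) t = (m \in t).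
Proof. by rewrite -has_pred1; apply: eq_has => m'; rewrite eq_maskE eq_sym. Qed.

Lemma all2_eq_mask t t' : all2 eq_mask t t' -> t = t'.
Proof.
by elim: t t' => [|m t IH] [|m' t'] //= /andP[]; rewrite eq_maskE => /eqP-> /IH->.
Qed.

Lemma uniq_map_inj (T1 T2 : eqType) (f : T1 -> T2) s :
  uniq (map f s) -> {in s &, injective f}.
Proof.
elim: s => [|x s IH] //= /andP[xs /IH{}IH] y z.
rewrite !inE => /predU1P[->|ys] /predU1P[->|zs] // e; last exact: IH.
  by move: xs; rewrite e map_f.
by move: xs; rewrite -e map_f.
Qed.

Lemma mem_cons (T : eqType) (y x : T) s : x \in s -> x \in y :: s.
Proof. by rewrite in_cons orbC => ->. Qed.

Lemma mem_map_cons (T : eqType) (x y : T) m (s : seq (seq T)) :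
  (x :: m \in map (cons y) s) = (x == y) && (m \in s).
Proof.
apply/mapP/andP => [[m' m's [-> ->]]|[/eqP-> ms]]; first by rewrite eqxx.
by exists m.
Qed.

Lemma nil_map_cons (T : eqType) (x : T) (s : seq (seq T)) :
  [::] \notin map (cons x) s.
Proof. by apply/mapP=> -[]. Qed.

Lemma submasksP C m : reflect (size m = size C /\ submask m C) (m \in submasks C).
Proof.
apply: (iffP idP).
  elim: C m => [|b C IH] m /=; first by rewrite inE => /eqP->; split.
  rewrite mem_cat; case: m => [|x m].
    by rewrite (negPf (nil_map_cons _ _)) orbF; case: b; rewrite ?(negPf (nil_map_cons _ _)).
  rewrite mem_map_cons; case: b => [|] /=; rewrite ?mem_map_cons.
    case/orP=> /andP[_ /IH[-> s]]; split=> // -[|i] //; exact: s.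
  by case/andP=> /eqP-> /IH[-> s]; split=> // -[|i] //; exact: s.
elim: C m => [|b C IH] [|x m] //= [] // [] sm /submask_cons[xb s].
rewrite mem_cat; case: x xb => [->//|_]; first by rewrite mem_map_cons IH.
by rewrite mem_map_cons IH // orbT.
Qed.

Lemma joins_oppc d c : size d = 40 -> joins d (oppc c) = joins d c.
Proof.
move=> sd; rewrite /joins.
have /permP <- : perm_eq (map oppc (signed d)) (signed d).
  by rewrite map_cat (mapK oppcK) perm_catC.
rewrite count_map; apply: eq_count => u /=.
by rewrite -oppcD !(mem_signed _ sd) !covers_oppc.
Qed.

Lemma all_decsP d : reflect
  [/\ size d.1 = 40, submask d.1 C0, d.2 = mask_and C0 (mask_not d.1), covers d.1 e1 &
      demicap_mask d.1 && demicap_mask d.2]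
  (d \in all_decs).
Proof.
rewrite /all_decs -lock mem_filter; apply: (iffP andP) => [[cond /mapP[d1]]|[s1 sb e2 x1 dd]].
  case/submasksP; rewrite size_C0 => s1 sb e; rewrite e /= in cond *.
  by case: ifP cond.
rewrite x1; split=> //; apply/mapP; exists d.1; first by apply/submasksP; rewrite size_C0.
by rewrite -e2; case: (d).
Qed.

Lemma covers_first r : size r = 40 -> has id r ->
  let p := nth zeroc points (find id r) in p != zeroc /\ covers r p.
Proof.
move=> sr hr p; have ltf : find id r < 40 by rewrite -sr -has_find.
have rp : covers r p by rewrite covers_nth //; exact: (nth_find false hr).
by split=> //; apply: contraTneq rp => ->; rewrite covers0.
Qed.

Lemma in_blocks r m : size r = 40 -> size m = 40 -> submask m r ->
  nth false m (find id r) -> 10 <= count id m -> cap_mask m ->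
  m \in search (table [::] points) 10 r (first r) [::].
Proof.
move=> sr sm smr mf c10 cm; have sf : size (first r) = 40 by rewrite size_map size_iota.
apply: search_complete; rewrite ?size_points //.
move=> i; case: (ltnP i 40) => lti; last by rewrite nth_default ?sf.
by rewrite (nth_map 0) ?size_iota // nth_iota // add0n => /eqP->.
Qed.

Lemma has_mask_and_not r m : size r = 40 -> size m = 40 -> count id m < count id r ->
  has id (mask_and r (mask_not m)).
Proof.
move=> sr sm; rewrite ltnNge; apply: contraR => /hasPn H; apply: count_submask => i ri.
have lti : i < 40 by rewrite ltnNge; apply: contraL ri => ?; rewrite nth_default ?sr.
have: nth false (mask_and r (mask_not m)) i \in mask_and r (mask_not m).
  by rewrite mem_nth // size_mask_and sr // size_map sm.
by move/H; rewrite nth_mask_and ri nth_mask_not ?sm //= negbK.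
Qed.

Lemma count_mask_not_C0 : count id (mask_not C0) = 30.
Proof.
rewrite count_map; have := count_predC id C0; rewrite size_C0 count_C0.
by move/(canRL (addKn _)).
Qed.

Section Model.

Variables (a : pt) (vec : code -> pt).
Hypothesis vecD : {morph vec : c d / addc c d >-> (c + d)%R}.
Hypothesis vec_inj : injective vec.
Hypothesis maxC : maxcap (spread a vec C0).

Local Notation spread := (spread a vec).
Local Notation C := (spread C0).

Lemma card_C : #|C| = 20.
Proof. by rewrite card_spread ?size_C0 ?count_C0. Qed.

(* [C] is maximal by assumption, so no bound on the size of caps without an anchor
   point has to be proved. *)
Lemma maxcapE S : maxcap S = cap S && (#|S| == 20).
Proof.
have [cC /forallP mC] := andP maxC.
rewrite /maxcap; case: (boolP (cap S)) => //= cS.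
apply/forallP/eqP=> [mS|-> T]; last by have := mC T; rewrite card_C.
apply/eqP; rewrite eqn_leq; have := mC S; rewrite cS card_C /= => -> /=.
by have := mS C; rewrite cC card_C.
Qed.

Lemma maxcap_spread m : size m = 40 -> maxcap (spread m) = cap_mask m && (count id m == 10).
Proof.
move=> sm; rewrite maxcapE cap_spread // card_spread //.
by rewrite -[20]/(10.*2) (inj_eq double_inj).
Qed.

Lemma cap_sub (S T : {set pt}) : S \subset T -> cap T -> cap S.
Proof.
move/subsetP=> ST /forall_inP H; apply/forall_inP=> x /ST/H/forall_inP H1.
by apply/forall_inP=> y /ST/H1/forall_inP H2; apply/forall_inP=> z /ST/H2.
Qed.

(** * Decompositions into demicaps and their images under [Phi] *)

Definition pair_of (d : bitseq * bitseq) : {set {set pt}} := [set spread d.1; spread d.2].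

Lemma size_dec2 d : d \in all_decs -> size d.2 = 40.
Proof.
by case/all_decsP=> s1 _ -> _ _; rewrite size_mask_and size_C0 // size_map s1.
Qed.

Lemma decsE : decs a C = [set Q in map pair_of all_decs].
Proof.
have [cC _] := andP maxC.
apply/setP=> Q; rewrite inE [RHS]inE; apply/existsP/mapP.
  case=> D0 /existsP[D0' /and5P[/eqP eQ dD0 dD0' dis0 /eqP eC0]].
  (* The halves are swapped if necessary, to agree with the convention that the first one contains
     [e1]. *)
  have [D [D' [{}eQ dD dD' dis [eC x1]]]] : exists D D' : {set pt}, [/\ Q = [set D; D'],
      demicap a D, demicap a D', [disjoint D & D'] & D :|: D' = C /\ (a + vec e1)%R \in D].
    have : (a + vec e1)%R \in C by rewrite mem_spread // C0_e1.
    rewrite -eC0 inE => /orP[x1|x1]; first by exists D0, D0'.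
    by exists D0', D0; rewrite setUC disjoint_sym setUC in dis0 *; split; rewrite // setUC.
  have [_ _ aD _] := and4P dD; have [_ _ aD' _] := and4P dD'.
  have sD := spread_mask_of vecD vec_inj aD; have sD' := spread_mask_of vecD vec_inj aD'.
  pose d1 := mask_of a vec D; pose d2 := mask_of a vec D'.
  have s1 : size d1 = 40 := size_mask_of _ _ _; have s2 : size d2 = 40 := size_mask_of _ _ _.
  have capD (S : {set pt}) : S \subset C -> cap S by move/cap_sub; apply.
  exists (d1, d2); last by rewrite eQ /pair_of sD sD'.
  apply/all_decsP; split => //=.
  - move=> i; case: (ltnP i 40) => lti; last by rewrite nth_default ?s1.
    by rewrite -!covers_nth // -!(mem_spread a vec_inj) sD -eC inE => ->.
  - apply: (@spread_inj a _ vec_inj _ _ s2).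
      by rewrite size_mask_and size_C0 // size_map s1.
    apply/setP=> x; have [c ->] := vec_surj a vec_inj x; rewrite !mem_spread //.
    case: (eqVneq c zeroc) => [->|nz]; first by rewrite covers_and !covers0 ?size_C0.
    rewrite covers_and covers_not // -!(mem_spread a vec_inj) sD sD' -eC inE.
    by case: (boolP (_ \in D)) => [/(disjointFr dis)->//|_]; rewrite andbT.
  - rewrite -!(@demicap_spread a _ vecD vec_inj) ?sD ?sD' ?dD ?dD' //; apply: capD;
    by rewrite -eC ?subsetUl ?subsetUr.
case=> d dd ->; have s2 := size_dec2 dd; case/all_decsP: dd => s1 sb e2 x1 /andP[dd1 dd2].
have memC c : covers C0 c = covers d.1 c || covers d.2 c.
  case: (eqVneq c zeroc) => [->|nz]; first by rewrite !covers0 ?size_C0.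
  rewrite e2 covers_and covers_not //; have := sb (point_index c).
  rewrite -![nth _ _ _]/(covers _ c).
  by do 2!case: covers => //; move=> /(_ isT).
have sub1 : spread d.1 \subset C.
  by apply/subsetP=> x; have [c ->] := vec_surj a vec_inj x; rewrite !mem_spread // memC => ->.
have sub2 : spread d.2 \subset C.
  by apply/subsetP=> x; have [c ->] := vec_surj a vec_inj x; rewrite !mem_spread // memC orbC => ->.
exists (spread d.1); apply/existsP; exists (spread d.2); rewrite eqxx.
rewrite !(demicap_spread vecD vec_inj) ?dd1 ?dd2 ?(cap_sub sub1) ?(cap_sub sub2) //=.
rewrite disjoint_subset; apply/andP; split.
  apply/subsetP=> x; have [c ->] := vec_surj a vec_inj x; rewrite inE !mem_spread // => m1.
  rewrite e2 covers_and covers_not // ?m1 ?andbF //.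
  by apply: contraTneq m1 => ->; rewrite covers0.
apply/eqP/setP=> x; have [c ->] := vec_surj a vec_inj x.
by rewrite inE !mem_spread // memC.
Qed.

Lemma PhiE d : d \in all_decs -> Phi a C (pair_of d) = spread (Phi_mask d).
Proof.
move=> dd; have s2 := size_dec2 dd; case/all_decsP: dd => s1 sb e2 x1 _.
have memC c : covers d.1 c || covers d.2 c -> covers C0 c.
  by case/orP; [apply: sb | rewrite e2 covers_and => /andP[]].
apply/setP=> x; have [c ->] := vec_surj a vec_inj x; rewrite inE !mem_spread //.
have sp : size (Phi_mask d) = 40 by rewrite size_map size_points.
case: (eqVneq c zeroc) => [->|nz].
  by rewrite (covers0 sp) (vec0 vecD) addr0 eqxx !andbF.
have -> : (a + vec c != a)%R.
  by rewrite -subr_eq0 addrC addKr -(vec0 vecD) (inj_eq vec_inj).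
have -> : covers (Phi_mask d) c = [&& ~~ covers C0 c, joins d.1 c == 2 & joins d.2 c == 2].
  rewrite {1}/covers (nth_map zeroc) ?size_points ?point_index_lt //.
  set q := nth _ _ _; have [->//|->] : q = c \/ q = oppc c.
    by case: (nth_point_index nz); rewrite -/q => e; [left | right; rewrite [in RHS]e oppcK].
  by rewrite covers_oppc !joins_oppc.
case: (boolP (covers C0 c)) => //= cC.
have [c1 c2] : ~~ covers d.1 c /\ ~~ covers d.2 c.
  by apply/norP; apply: contra cC => /memC.
have n1 (e : bitseq) : size e = 40 -> ~~ covers e c ->
    (ncomplete (a + vec c)%R (spread e) == 1) = (joins e c == 2).
  move=> se ce; rewrite -(@ncomplete_spread a _ vecD vec_inj _ _ se ce).
  by rewrite -[2]/(1.*2) (inj_eq double_inj).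
rewrite -!n1 //; apply/forall_inP/andP=> [H|[H1 H2] D].
  by split; apply: H; rewrite !inE eqxx ?orbT.
by rewrite !inE => /orP[]/eqP->.
Qed.

(** * Good partitions that contain the cap *)

Lemma anchor_unique a' : anchor a' C -> a' = a.
Proof.
have [c ->] := vec_surj a vec_inj a' => /andP[_ /forall_inP H].
case: (eqVneq c zeroc) => [->|nz]; first by rewrite (vec0 vecD) addr0.
have /allP/(_ c (mem_codes c)) := C0_not_translated.
rewrite (negPf nz) orFb => /hasP[u]; rewrite (mem_signed _ size_C0) => uC /negP[].
(* Reflection in [a + vec c] followed by reflection in [a] is the translation by [vec c]. *)
have := H (a + vec u)%R; rewrite !mem_spread // => /(_ uC).
rewrite -addrA (addrCA (vec c)) -vecD third_point -(vecN vecD) mem_spread //.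
by rewrite covers_oppc.
Qed.

Definition block_seq (t : seq bitseq) : seq {set pt} := [set a] :: map spread (C0 :: t).
Definition block (t : seq bitseq) : {set {set pt}} := [set B in block_seq t].

Lemma mem_block t m : t \in all_splits -> size m = 40 ->
  (spread m \in block t) = (m \in C0 :: t).
Proof.
move=> /all_splitsP[_ _ H _] sm; rewrite inE in_cons.
have -> : (spread m == [set a]) = false.
  apply/eqP=> /setP/(_ a); rewrite inE eqxx.
  by rewrite -{1}[a]addr0 -(vec0 vecD) mem_spread // covers0.
apply/mapP/idP => [[m' m't e]|mt]; last by exists m.
have [s' _ _] := H _ m't.
by rewrite (@spread_inj a _ vec_inj _ _ sm s' e).
Qed.

Lemma uniq_block_seq t : t \in all_splits -> uniq (block_seq t).
Proof.
move=> /all_splitsP[_ u H _]; rewrite cons_uniq map_inj_in_uniq ?u ?andbT.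
  apply/mapP=> -[m /H[sm _ _] /setP/(_ a)]; rewrite inE eqxx.
  by rewrite -{1}[a]addr0 -(vec0 vecD) mem_spread // covers0.
move=> m1 m2 /H[s1 _ _] /H[s2 _ _]; exact: (@spread_inj a _ vec_inj).
Qed.

Lemma block_good t : t \in all_splits -> good_partition (block t).
Proof.
move=> tP; have [s3 u H cnt] := all_splitsP tP; have uB := uniq_block_seq tP.
have inB m : m \in C0 :: t -> maxcap (spread m) && anchor a (spread m).
  case/H=> sm c10 cm; rewrite (maxcap_spread sm) cm c10.
  by rewrite (@anchor_spread a _ vecD vec_inj _ sm).
apply/existsP; exists a; apply/and4P; split.
- by rewrite in_set mem_head.
- by rewrite cardsE (card_uniqP uB) /= size_map s3.
- have cov : cover (block t) = [set: pt].
    apply/setP=> x; rewrite inE; apply/bigcupP; have [c ->] := vec_surj a vec_inj x.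
    case: (eqVneq c zeroc) => [->|nz].
      by exists [set a]; [rewrite in_set mem_head | rewrite in_set1 (vec0 vecD) addr0].
    have := cnt _ (point_index_lt nz) => c1.
    have /hasP[m mt mc] : has (fun m => nth false m (point_index c)) (C0 :: t).
      by rewrite has_count c1.
    exists (spread m); last by rewrite mem_spread.
    by rewrite in_set in_cons map_f ?orbT.
  rewrite /partition cov eqxx /=; apply/andP; split.
    (* Disjointness follows by counting: the blocks cover 81 points, and their sizes add up to
       $1+4\cdot 20=81$. *)
    rewrite /trivIset cov cardsT card_pt.
    have -> : \sum_(B in block t) #|B| = \sum_(B <- block_seq t) #|B|.
      by rewrite (big_uniq _ uB); apply: eq_bigl => B; rewrite inE.
    rewrite big_cons cards1 big_map.
    have -> : \sum_(m <- C0 :: t) #|spread m| = \sum_(m <- C0 :: t) 20.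
      by apply: eq_big_seq => m /H[sm c10 _]; rewrite (card_spread a vec_inj sm) c10.
    have s4 : size (C0 :: t) = 4 by congr _.+1.
    by rewrite big_const_seq count_predT s4.
  rewrite in_set in_cons negb_or eq_sym -card_gt0 cards1 ltn0Sn andTb.
  apply/mapP=> -[m /H[sm c10 _] e].
  by have := card_spread a vec_inj sm; rewrite -e cards0 c10.
apply/forall_inP=> B; rewrite in_set in_cons => /predU1P[->|]; first by rewrite eqxx.
by case/mapP=> m /inB mt ->; apply/implyP.
Qed.

(** By [anchor_unique] every large block is anchored at [a], hence has a mask. The three blocks
    besides [C] are named in the order in which [splits] selects them: [A] contains the first point
    outside [C], [B] the first point outside [C] and [A], and [D] is what remains. *)
Lemma good_block P : good_partition P -> C \in P ->
  exists2 t, t \in all_splits & P = block t.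
Proof.
case/existsP=> a' /and4P[aP /eqP P5 partP /forall_inP H] CP.
have neC : C != [set a'].
  by apply/eqP=> e; have := card_C; rewrite e cards1.
have /anchor_unique ea : anchor a' C by have /implyP/(_ neC)/andP[] := H _ CP.
rewrite {}ea in aP H neC.
pose M (B : {set pt}) := mask_of a vec B.
have sM B : size (M B) = 40 := size_mask_of _ _ _.
have HB B : B \in P -> B != [set a] ->
    [/\ forall c, covers (M B) c = (a + vec c \in B)%R, spread (M B) = B,
         count id (M B) = 10 & cap_mask (M B)].
  move=> BP /(implyP (H _ BP))/andP[mB aB].
  have eB : spread (M B) = B := spread_mask_of vecD vec_inj aB.
  move: mB; rewrite -{1}eB maxcap_spread // => /andP[cB /eqP kB].
  by split=> // c; rewrite (covers_mask_of vecD c aB).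
have same x B1 B2 : B1 \in P -> B2 \in P -> x \in B1 -> x \in B2 -> B1 = B2.
  move=> P1 P2 x1 x2; have /and3P[_ /trivIsetP T _] := partP.
  by apply/eqP; apply: contraTT x2 => /(T _ _ P1 P2)/disjointFr->.
have cov c : c != zeroc -> exists B, [/\ B \in P, B != [set a] & (a + vec c)%R \in B].
  move=> nz; have := cover_partition partP => /setP/(_ (a + vec c)%R).
  rewrite in_setT => /bigcupP[B BP cB]; exists B; split=> //.
  apply: contraTneq cB => ->; rewrite inE -subr_eq0 addrC addKr -(vec0 vecD).
  by rewrite (inj_eq vec_inj).
have inmC c : covers C0 c = (a + vec c \in C)%R by rewrite mem_spread.
set r := mask_not C0; have sr : size r = 40 by rewrite size_map size_C0.
have hr : has id r by rewrite has_count count_mask_not_C0.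
have [p0nz rp0] := covers_first sr hr; set p0 := nth _ _ _ in p0nz rp0.
have [A [AP neA p0A]] := cov _ p0nz; have [MA eA kA cA] := HB _ AP neA.
have AC : A != C.
  by apply: contraTneq rp0 => e; rewrite covers_not ?size_C0 // inmC -e p0A.
have lt_nz i : i < 40 -> nth zeroc points i != zeroc.
  move=> lti; apply/eqP=> e; have := point_index_nth lti; rewrite e point_index0 => e40.
  by rewrite -e40 ltnn in lti.
have out m i : size m = 40 -> nth false m i -> i < 40.
  by move=> sm mi; rewrite ltnNge; apply: contraL mi => ?; rewrite nth_default ?sm.
have disj B B' i : B \in P -> B != [set a] -> B' \in P -> B' != [set a] -> B != B' ->
    nth false (M B) i -> nth false (M B') i -> False.
  move=> BP nB BP' nB' ne /[dup] /(out _ _ (sM B)) lti.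
  have [MB _ _ _] := HB _ BP nB; have [MB' _ _ _] := HB _ BP' nB'.
  rewrite -!covers_nth // MB MB' => b b'; move: ne.
  by rewrite (same _ _ _ BP BP' b b') eqxx.
have notmM B i : i < 40 -> nth false (mask_not (M B)) i = ~~ nth false (M B) i.
  by move=> lti; apply: nth_mask_not; rewrite sM.
have notmC i : i < 40 -> nth false r i = ~~ nth false C0 i.
  by move=> lti; apply: nth_mask_not; rewrite size_C0.
have MC : M C = C0.
  by have [_ e _ _] := HB _ CP neC; apply: (@spread_inj a _ vec_inj _ _ (sM C) size_C0).
have subr B : B \in P -> B != [set a] -> B != C -> submask (M B) r.
  move=> BP nB BC i Bi; rewrite (notmC i (out _ _ (sM B) Bi)) -MC.
  by apply/negP; apply: (disj B C i BP nB CP neC BC Bi).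
have A1 : M A \in search (table [::] points) 10 r (first r) [::].
  apply: (in_blocks sr (sM A) (subr A AP neA AC) _ _ cA); last by rewrite kA.
  have lt0 : find id r < 40 by move: hr; rewrite has_find sr.
  by rewrite -(covers_nth _ lt0) MA; exact: p0A.
set r1 := mask_and r (mask_not (M A)).
have sr1 : size r1 = 40 by rewrite size_mask_and sr // size_map.
have hr1 : has id r1 by apply: (has_mask_and_not sr (sM A)); rewrite kA count_mask_not_C0.
have [p1nz rp1] := covers_first sr1 hr1; set p1 := nth _ _ _ in p1nz rp1.
have [B [BP neB p1B]] := cov _ p1nz; have [MB eB kB cB] := HB _ BP neB.
move: (rp1); rewrite /r1 /r covers_and (covers_not size_C0 p1nz) (covers_not (sM A) p1nz).
rewrite inmC MA => /andP[p1C p1A].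
have BC : B != C by apply: contraNneq p1C => <-.
have BA : B != A by apply: contraNneq p1A => <-.
have B1 : M B \in search (table [::] points) 10 r1 (first r1) [::].
  apply: (in_blocks sr1 (sM B) _ _ _ cB); last by rewrite kB.
  - move=> i Bi; have lti := out _ _ (sM B) Bi.
    rewrite nth_mask_and (subr B BP neB BC i Bi) (notmM A i lti) andTb.
    by apply/negP; apply: (disj B A i BP neB AP neA BA Bi).
  - have lt1 : find id r1 < 40 by move: hr1; rewrite has_find sr1.
    by rewrite -(covers_nth _ lt1) MB; exact: p1B.
have [D PE] : exists D, P :\ [set a] :\ C :\ A :\ B = [set D].
  apply/cards1P; apply/eqP; have := P5.
  rewrite [#|P|](cardsD1 [set a]) aP [#|P :\ _|](cardsD1 C) !inE neC CP.
  rewrite [#|_ :\ C|](cardsD1 A) !inE AC neA AP.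
  by rewrite [#|_ :\ A|](cardsD1 B) !inE BA BC neB BP; case.
have /and5P[DB DA DC neD DP] : [&& D != B, D != A, D != C, D != [set a] & D \in P].
  by have := set11 D; rewrite -PE !inE.
have [MD eD _ _] := HB _ DP neD.
have eMD : M D = mask_and r1 (mask_not (M B)).
  have sr2 : size (mask_and r1 (mask_not (M B))) = 40 by rewrite size_mask_and sr1 // size_map.
  apply: (@eq_from_nth _ false) => [|i]; first by rewrite (sM D) sr2.
  rewrite (sM D) => lti.
  rewrite nth_mask_and; apply/idP/andP => [Di|[]].
    rewrite nth_mask_and (subr D DP neD DC i Di) (notmM A i lti) (notmM B i lti) andTb.
    split; apply/negP; first exact: (disj D A i DP neD AP neA DA Di).
    exact: (disj D B i DP neD BP neB DB Di).
  rewrite nth_mask_and (notmC i lti) (notmM A i lti) (notmM B i lti).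
  rewrite -!(covers_nth _ lti) inmC MA MB MD.
  have [X [XP neX Xi]] := cov _ (lt_nz _ lti) => /andP[nC nA] nB.
  suff <- : X = D by [].
  apply/eqP; rewrite -in_set1 -PE !inE XP neX.
  by rewrite !andbT; apply/and3P; split; apply: contraTneq Xi => ->.
exists [:: M A; M B; M D]; first by rewrite eMD /all_splits -lock; exact: mem_splits A1 B1.
have -> : P = [set a] |: (C |: (A |: (B |: [set D]))).
  have C' : C \in P :\ [set a] by rewrite in_setD1 neC.
  have A' : A \in P :\ [set a] :\ C by rewrite !in_setD1 AC neA.
  have B' : B \in P :\ [set a] :\ C :\ A by rewrite !in_setD1 BA BC neB.
  by rewrite -PE (setD1K B') (setD1K A') (setD1K C') (setD1K aP).
apply/setP=> X; rewrite [RHS]in_set !in_setU1 in_set1 /block_seq !map_cons eA eB eD.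
by rewrite !in_cons in_nil orbF.
Qed.

Lemma block_inj : {in all_splits &, injective block}.
Proof.
move=> t t' tP tP' e; have [/allP inj _ _ _ _] := all_splits_check.
have /allP/(_ t' tP') := inj t tP.
have [_ u H _] := all_splitsP tP; move: u; rewrite cons_uniq => /andP[C0t _].
have -> : all (fun m => has (eq_mask m) t') t.
  apply/allP=> m mt; rewrite has_eq_mask; have [sm _ _] := H m (mem_cons C0 mt).
  have := mem_block tP sm; rewrite e (mem_block tP' sm) !in_cons mt orbT.
  by case/orP=> [/eqP em|mt']; [rewrite -em mt in C0t | exact: mt'].
exact: all2_eq_mask.
Qed.

(** [block] is a bijection from the listed splits onto the good partitions containing [C]. The case
    [m = C0] is excluded because [C] is a block of all of them without being listed in any split. *)
Lemma card_partitions m : size m = 40 -> m != C0 ->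
  #|[set P | [&& good_partition P, C \in P & spread m \in P]]|
  = count (fun t => m \in t) all_splits.
Proof.
move=> sm mC; rewrite -size_filter; set F := filter _ _.
have Fs t : t \in F -> t \in all_splits by rewrite mem_filter => /andP[].
have -> : [set P | [&& good_partition P, C \in P & spread m \in P]] = [set P in map block F].
  apply/setP=> P; rewrite [LHS]in_set [RHS]in_set; apply/and3P/mapP => [[gP CP mP]|[t tF ->]].
    have [t tP eP] := good_block gP CP; exists t => //.
    by move: mP; rewrite eP mem_block // in_cons (negPf mC) mem_filter tP andbT.
  have tP := Fs _ tF; rewrite mem_filter in tF; have /andP[mt _] := tF.
  by rewrite block_good // !mem_block ?size_C0 // mem_head in_cons mt orbT.
rewrite cardsE -(size_map block); apply/card_uniqP; rewrite map_inj_in_uniq.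
  by have [_ u _ _ _] := all_splits_check; apply: filter_uniq.
by move=> t t' /Fs tP /Fs tP'; apply: block_inj.
Qed.

(** That [C'] is anchored at [a] is not part of being completable; it is read off from the partition
    that contains both caps. *)
Lemma completableP C' : reflect
  (exists2 m, m \in single_blocks all_splits & C' = spread m) (completable 1 C C').
Proof.
have singleE m : (m \in single_blocks all_splits) =
    (count (fun t => m \in t) all_splits == 1) && (m \in flatten all_splits).
  by rewrite mem_filter (eq_count (has_eq_mask m)).
rewrite /completable maxC andTb.
apply: (iffP and3P) => [[mC' dis /eqP c1]|[m]].
  have /card_gt0P[P] : 0 < #|[set P | [&& good_partition P, C \in P & C' \in P]]| by rewrite c1.
  rewrite in_set => /and3P[gP CP C'P]; have [t tP eP] := good_block gP CP.
  move: C'P; rewrite eP in_set in_cons => /predU1P[eC'|/mapP[m mt eC']].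
    by move: mC'; rewrite maxcapE eC' cards1 andbF.
  have [_ _ H _] := all_splitsP tP; have [sm _ _] := H m mt.
  have mC : m != C0.
    by apply: contraTneq dis => e; rewrite eC' e -setI_eq0 setIid -card_gt0 card_C.
  exists m => //; rewrite singleE; move: c1; rewrite eC' card_partitions // => -> /=.
  apply/flattenP; exists t => //; move: mt; rewrite in_cons => /predU1P[e|//].
  by rewrite e eqxx in mC.
rewrite singleE => /andP[c1 /flattenP[t tP mt]] ->.
have [_ u H cnt] := all_splitsP tP; have [sm km cm] := H m (mem_cons C0 mt).
move: u; rewrite cons_uniq => /andP[C0t _].
have mC : m != C0 by apply: contraNneq C0t => <-.
rewrite maxcap_spread // cm km card_partitions //; split=> //.
rewrite disjoint_subset; apply/subsetP=> x; have [c ->] := vec_surj a vec_inj x.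
rewrite inE !mem_spread // => Cc; apply/negP=> mc.
have nz : c != zeroc by apply: contraTneq Cc => ->; rewrite covers0 ?size_C0.
have := cnt _ (point_index_lt nz); rewrite [count _ _]/(nth false C0 (point_index c) + _).
rewrite -/(covers C0 c) Cc => -[/eqP]; rewrite -leqn0 leqNgt -has_count.
by case/negP; apply/hasP; exists m.
Qed.

Lemma theorem_in_coordinates :
  (forall Q, Q \in decs a C ->
     maxcap (Phi a C Q) /\ completable 1 C (Phi a C Q)) /\
  {in decs a C &, injective (Phi a C)} /\
  [set Phi a C Q | Q in decs a C] = [set C' : {set pt} | completable 1 C C'] /\
  #|decs a C| = 36 /\
  #|[set C' : {set pt} | completable 1 C C']| = 36.
Proof.
have [_ _ _ uL pL] := all_splits_check.
have uphi : uniq (map Phi_mask all_decs) by rewrite (perm_uniq pL).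
have mem_dec Q : reflect (exists2 d, d \in all_decs & Q = pair_of d) (Q \in decs a C).
  by rewrite decsE in_set; apply: mapP.
have sphi d : size (Phi_mask d) = 40 by rewrite size_map size_points.
have phi_inj d d' : d \in all_decs -> d' \in all_decs ->
    Phi a C (pair_of d) = Phi a C (pair_of d') -> d = d'.
  move=> dd dd'; rewrite !PhiE // => /(@spread_inj a _ vec_inj _ _ (sphi d) (sphi d')).
  exact: (uniq_map_inj uphi).
have compl Q : Q \in decs a C -> completable 1 C (Phi a C Q).
  case/mem_dec=> d dd ->; apply/completableP; exists (Phi_mask d); last exact: PhiE.
  by rewrite -(perm_mem pL) map_f.
have injPhi : {in decs a C &, injective (Phi a C)}.
  by move=> Q Q' /mem_dec[d dd ->] /mem_dec[d' dd' ->] /(phi_inj _ _ dd dd')->.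
have imE : [set Phi a C Q | Q in decs a C] = [set C' : {set pt} | completable 1 C C'].
  apply/setP=> C'; rewrite in_set; apply/imsetP/completableP => [[Q QD ->]|[m mL ->]].
    exact/completableP/compl.
  move: mL; rewrite -(perm_mem pL) => /mapP[d dd ->].
  by exists (pair_of d); [apply/mem_dec; exists d | rewrite PhiE].
have cardD : #|decs a C| = 36.
  rewrite decsE cardsE -size_all_decs -(size_map pair_of); apply/card_uniqP.
  rewrite map_inj_in_uniq; first by have := uphi; apply: map_uniq.
  by move=> d d' dd dd' e; apply: phi_inj; rewrite ?e.
split=> [Q QD|].
  by have cQ := compl Q QD; split; [case/and4P: cQ | exact: cQ].
do 3!split=> //; by rewrite -imE card_in_imset.
Qed.

End Model.

(** * Normal position of a maximal cap *)

Lemma linear_codeD g : {morph linear_code g : c d / addc c d}.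
Proof.
have addcACA : interchange addc addc.
  by move=> x y z t; rewrite -!addcA (addcA y) (addcC y) !addcA.
have scalecD s t c : scalec (addt s t) c = addc (scalec s c) (scalec t c).
  by case: s t c => [[]|] [[]|] [[[[[]|] [[]|]] [[]|]] [[]|]].
move=> [[[c1 c2] c3] c4] [[[d1 d2] d3] d4]; rewrite [addc (_, _, _, _) _]/=.
by rewrite /linear_code !scalecD [RHS]addcACA; congr addc; apply: addcACA.
Qed.

Local Open Scope ring_scope.

Definition comb (v1 v2 v3 v4 : pt) (c : code) : pt :=
  let: (c1, c2, c3, c4) := c in
  scalt c1 *: v1 + scalt c2 *: v2 + (scalt c3 *: v3 + scalt c4 *: v4).

Lemma combD v1 v2 v3 v4 : {morph comb v1 v2 v3 v4 : c d / addc c d >-> c + d}.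
Proof.
move=> [[[c1 c2] c3] c4] [[[d1 d2] d3] d4]; rewrite [addc _ _]/= /comb !scaltD !scalerDl.
by rewrite [RHS]addrACA; congr (_ + _); apply: addrACA.
Qed.

Lemma additive_inj (f : code -> pt) : {morph f : c d / addc c d >-> c + d} ->
  (forall c, f c = 0 -> c = zeroc) -> injective f.
Proof.
move=> fD ker c d e; have f0 : f zeroc = 0.
  by apply: (addrI (f zeroc)); rewrite -fD addr0.
have : f (addc c (oppc d)) = 0 by rewrite fD e -fD addcN.
by move/ker/(congr1 (addc^~ d)); rewrite -addcA (addcC _ d) addcN addc0 addcC addc0.
Qed.

Definition triples : seq (trit * trit * trit) :=
  [seq (u, t) | u <- [seq (s, t) | s <- trits, t <- trits], t <- trits].

Definition comb3 (v1 v2 v3 : pt) (t : trit * trit * trit) : pt :=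
  scalt t.1.1 *: v1 + scalt t.1.2 *: v2 + scalt t.2 *: v3.

(* Trits coerce to booleans by [isSome], so the sum is the number of nonzero
   coefficients. *)
Definition odd_weight (t : trit * trit * trit) : bool :=
  odd (t.1.1 + t.1.2 + t.2)%N.

(** A combination $p+q$ of weight two that lies in [U] forms a line with $p$ and $q$ after negation,
    unless two of the three points coincide; either way it equals $-p$, of weight one. As 0 is not
    in [U], the part of [U] in the span consists of combinations of odd weight, of which there are
    $6+8=14$. *)
Lemma new_vector (U : {set pt}) v1 v2 v3 :
  0 \notin U -> {in U, forall x, - x \in U} ->
  {in U & &, forall x y z, x != y -> y != z -> x != z -> x + y + z != 0} ->
  (14 < #|U|)%N -> v1 \in U -> v2 \in U -> v3 \in U ->
  exists2 v, v \in U & forall t, v != comb3 v1 v2 v3 t.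
Proof.
move=> U0 UN Uline U14 U1 U2 U3.
have scaleU t v : v \in U -> t != None -> scalt t *: v \in U.
  by case: t => [[]|] // vU _; rewrite ?scale1r ?scaleN1r ?UN.
(* Unless p = q, the points p, q and -(p + q) form a line. *)
have addU p q : p \in U -> q \in U -> p + q \in U -> p + q = - p.
  move=> pU qU sU; case: (eqVneq p q) => [->|pq].
    by apply/eqP; rewrite -addr_eq0 pt_add3.
  case: (eqVneq q (- (p + q))) => [e|qne].
    case/eqP: pq; apply: (addIr (q + q)); rewrite !addrA pt_add3.
    by apply/eqP; rewrite addr_eq0 -[p + q]opprK -e.
  case: (eqVneq p (- (p + q))) => [e|pne]; first by rewrite {2}e opprK.
  by have := Uline p q _ pU qU (UN _ sU) pq qne pne; rewrite subrr eqxx.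
pose L := [seq comb3 v1 v2 v3 t | t <- triples & odd_weight t].
have memL t : odd_weight t -> comb3 v1 v2 v3 t \in L.
  move=> wt; apply: map_f; rewrite mem_filter wt.
  by case: t {wt} => [[[[]|] [[]|]] [[]|]].
case: (boolP [exists v in U, v \notin L]) => [/exists_inP[v vU vL]|].
  exists v => // t; apply/eqP=> e; case/negP: vL; move: vU; rewrite {}e.
  have [/memL//|] := boolP (odd_weight t).
  have oppZ s (w : pt) : scalt (oppt s) *: w = - (scalt s *: w).
    by case: s => [[]|] /=; rewrite ?scaleN1r ?scale1r ?scale0r ?oppr0 ?opprK.
  case: t => [[c1 c2] c3]; rewrite /comb3 /=.
  case: (eqVneq c1 None) => [->|nz1].
    case: (eqVneq c2 None) => [->|nz2].
      case: c3 => [//|_]; rewrite !scale0r !addr0 => z; case/negP: U0; exact: z.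
    case: (eqVneq c3 None) => [->|nz3 _]; first by case: c2 nz2.
    rewrite scale0r add0r => vU; rewrite addU ?scaleU // -oppZ.
    have := memL (None, oppt c2, None); rewrite /comb3 /= !scale0r add0r addr0; apply.
    by case: c2 nz2 {vU} => [[]|].
  case: (eqVneq c2 None) => [->|nz2].
    case: (eqVneq c3 None) => [->|nz3 _]; first by case: c1 nz1.
    rewrite scale0r addr0 => vU; rewrite addU ?scaleU // -oppZ.
    have := memL (oppt c1, None, None); rewrite /comb3 /= !scale0r !addr0; apply.
    by case: c1 nz1 {vU} => [[]|].
  case: (eqVneq c3 None) => [->|nz3]; last by case: c1 c2 c3 nz1 nz2 nz3 => [?|] [?|] [?|].
  move=> _; rewrite scale0r addr0 => vU; rewrite addU ?scaleU // -oppZ.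
  have := memL (oppt c1, None, None); rewrite /comb3 /= !scale0r !addr0; apply.
  by case: c1 nz1 {vU} => [[]|].
rewrite negb_exists => /forallP H.
have /subset_leq_card : U \subset L.
  by apply/subsetP=> x xU; have := H x; rewrite xU negbK.
by move/leq_trans/(_ (card_size _)); rewrite leqNgt U14.
Qed.

Definition stdvec (c : code) : pt :=
  let: (c1, c2, c3, c4) := c in \row_i nth 0 [:: scalt c1; scalt c2; scalt c3; scalt c4] i.

Lemma stdvecD : {morph stdvec : c d / addc c d >-> c + d}.
Proof.
move=> [[[c1 c2] c3] c4] [[[d1 d2] d3] d4]; apply/rowP=> i; rewrite !mxE.
by case: i => -[|[|[|[|i]]]] //= _; rewrite scaltD.
Qed.

Lemma stdvec_inj : injective stdvec.
Proof.
apply: additive_inj stdvecD _ => -[[[c1 c2] c3] c4] /rowP e.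
have scalt0 t : scalt t = 0 -> t = None by case: t => [[]|].
have /scalt0-> : scalt c1 = 0 by have := e ord0; rewrite !mxE.
have /scalt0-> : scalt c2 = 0 by have := e (inord 1); rewrite !mxE inordK.
have /scalt0-> : scalt c3 = 0 by have := e (inord 2); rewrite !mxE inordK.
by have /scalt0-> : scalt c4 = 0 by have := e (inord 3); rewrite !mxE inordK.
Qed.

(** The comparison is with the cap that [C0] gives in standard coordinates around the origin. *)
Lemma maxcap_ge20 C : maxcap C -> (20 <= #|C|)%N.
Proof.
case/andP=> _ /forallP/(_ (spread 0 stdvec C0))/implyP.
rewrite (card_spread _ stdvec_inj size_C0) count_C0; apply.
by rewrite (cap_spread _ stdvecD stdvec_inj size_C0) cap_mask_C0.
Qed.

Lemma frame_exists C a : maxcap C -> anchor a C ->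
  exists vec, [/\ {morph vec : c d / addc c d >-> c + d}, injective vec &
    forall c, c \in [:: e1; e2; e3; e4] -> a + vec c \in C].
Proof.
move=> mC aC; have /andP[cC _] := mC; have /andP[nC /forall_inP sC] := aC.
pose U := [set x | a + x \in C].
have cU : #|U| = #|C|.
  have -> : U = +%R a @^-1: C by apply/setP=> x; rewrite !inE.
  exact/card_preimset/addrI.
have U0 : 0 \notin U by rewrite inE addr0.
have UN : {in U, forall x, - x \in U}.
  by move=> x; rewrite !inE => /sC; rewrite third_point.
have Uline : {in U & &, forall x y z, x != y -> y != z -> x != z -> x + y + z != 0}.
  move=> x y z; rewrite !inE => xC yC zC xy yz xz.
  have /forall_inP/(_ _ yC)/forall_inP/(_ _ zC) := forall_inP cC _ xC.
  rewrite /is_line !(inj_eq (addrI a)) xy yz xz; apply: contra => /eqP s0.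
  by rewrite [a + x + _]addrACA (addrACA (a + a)) pt_add3 s0 addr0 eqxx.
have U14 : (14 < #|U|)%N by rewrite cU (leq_trans _ (maxcap_ge20 mC)).
have new := new_vector U0 UN Uline U14.
have /card_gt0P[v1 U1] : (0 < #|U|)%N by apply: leq_ltn_trans U14.
(* Vectors may be repeated, so the same lemma also avoids spans of one or two vectors. *)
have [v2 U2 n2] := new _ _ _ U1 U1 U1.
have [v3 U3 n3] := new _ _ _ U1 U2 U2.
have [v4 U4 n4] := new _ _ _ U1 U2 U3.
exists (comb v1 v2 v3 v4); split; first exact: combD.
  apply: additive_inj (@combD _ _ _ _) _ => -[[[c1 c2] c3] c4].
  have solve t (u v : pt) : t != None -> u + scalt t *: v = 0 -> v = scalt (oppt t) *: u.
    case: t => [[]|] // _ /=; rewrite ?scale1r ?scaleN1r.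
      by move/eqP; rewrite addrC addr_eq0 => /eqP.
    by move/eqP; rewrite subr_eq0 => /eqP.
  have mulZ s t (u : pt) : scalt s *: (scalt t *: u) = scalt (mult s t) *: u.
    by rewrite scalerA scaltM.
  (* In a nontrivial relation, the last nonzero coefficient would express its vector by the earlier
     ones. *)
  rewrite /comb addrA; case: (eqVneq c4 None) => [->|z4 /(solve _ _ _ z4) e]; last first.
    case/eqP: (n4 (mult (oppt c4) c1, mult (oppt c4) c2, mult (oppt c4) c3)).
    by rewrite e !scalerDr !mulZ.
  rewrite scale0r addr0; case: (eqVneq c3 None) => [->|z3 /(solve _ _ _ z3) e]; last first.
    case/eqP: (n3 (mult (oppt c3) c1, mult (oppt c3) c2, None)).
    by rewrite e !scalerDr !mulZ /comb3 /= scale0r addr0.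
  rewrite scale0r addr0; case: (eqVneq c2 None) => [->|z2 /(solve _ _ _ z2) e]; last first.
    case/eqP: (n2 (mult (oppt c2) c1, None, None)).
    by rewrite e !mulZ /comb3 /= !scale0r !addr0.
  rewrite scale0r addr0; case: c1 => [[]|] //=; rewrite ?scale1r ?scaleN1r => e.
    by case/negP: U0; rewrite -e.
  by case/negP: U0; rewrite -e UN.
have inU v : v \in U -> a + v \in C by rewrite inE.
by move=> c; rewrite !inE => /or4P[]/eqP->; rewrite /comb /= !scale0r scale1r ?addr0 ?add0r inU.
Qed.

(** The mask of [C] in a frame taken from [C] has at least ten points, so it is among [frame_caps],
    and [frame_check] yields both the exact number ten and a monomial map [g]. The frame is then
    precomposed with [g]. *)
Lemma coordinates_exist C a : maxcap C -> anchor a C ->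
  exists vec, [/\ {morph vec : c d / addc c d >-> c + d}, injective vec &
    C = spread a vec C0].
Proof.
move=> mC aC; have [vec [vecD vec_inj vecE]] := frame_exists mC aC.
set m := mask_of a vec C; have sm : size m = 40%N := size_mask_of _ _ _.
have eC : spread a vec m = C := spread_mask_of vecD vec_inj aC.
have kC : #|C| = (count id m).*2 by rewrite -eC (card_spread a vec_inj sm).
have inmE c : c \in [:: e1; e2; e3; e4] -> covers m c.
  by move/vecE; rewrite -(covers_mask_of vecD _ aC).
have cm : cap_mask m.
  by have /andP[] := mC; rewrite -{1}eC (cap_spread a vecD vec_inj sm).
have : m \in frame_caps.
  apply: search_complete; rewrite ?size_points ?size_nseq ?size_cat ?size_nseq //.
  - move=> i mi; rewrite nth_nseq ifT //.
    by rewrite ltnNge; apply: contraL mi => ?; rewrite nth_default ?sm.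
  - have [n0 n1 n2 n3] := points_e.
    move=> i; case: (ltnP i 4) => [lt4 _|ge4]; last first.
      by rewrite nth_cat size_nseq ltnNge ge4 !nth_nseq; case: ifP.
    rewrite -covers_nth ?(leq_trans lt4) //; apply: inmE.
    by case: i lt4 => [|[|[|[|i]]]] // _; rewrite ?n0 ?n1 ?n2 ?n3 !inE eqxx ?orbT.
  - by rewrite -leq_double -kC; apply: maxcap_ge20.
move/(allP frame_check)=> /andP[/eqP k10 /hasP[g _]]; rewrite /image_of_C0.
case: ifP => // /allP gC0 /allP ker.
have vec'D : {morph vec \o linear_code g : c d / addc c d >-> c + d}.
  by move=> c d /=; rewrite linear_codeD vecD.
have vec'_inj : injective (vec \o linear_code g).
  apply: additive_inj vec'D _ => c /=; rewrite -(vec0 vecD) => /vec_inj e.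
  by have := ker c (mem_codes c); rewrite e eqxx orbF => /eqP.
exists (vec \o linear_code g); split=> //; apply/eqP; rewrite eq_sym eqEcard.
rewrite kC k10 (card_spread a vec'_inj size_C0) count_C0 leqnn andbT.
apply/subsetP=> _ /imsetP[c cC ->] /=; rewrite -eC (mem_spread a vec_inj).
have linN d : linear_code g (oppc d) = oppc (linear_code g d).
  by apply: vec_inj; rewrite (vecN vecD) -(vecN vec'D).
have : c \in signed C0 by rewrite (mem_signed _ size_C0).
rewrite mem_cat.
by case/orP=> [/gC0|/mapP[p /gC0 gp ->]]; rewrite ?linN ?covers_oppc.
Qed.

Local Close Scope ring_scope.

Theorem theorem4p1 (C : {set pt}) (a : pt) :
  maxcap C -> anchor a C ->
  (forall Q, Q \in decs a C ->
     maxcap (Phi a C Q) /\ completable 1 C (Phi a C Q)) /\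
  {in decs a C &, injective (Phi a C)} /\
  [set Phi a C Q | Q in decs a C] = [set C' : {set pt} | completable 1 C C'] /\
  #|decs a C| = 36 /\
  #|[set C' : {set pt} | completable 1 C C']| = 36.
Proof.
move=> mC aC; have [vec [vecD vec_inj eC]] := coordinates_exist mC aC.
by move: mC; rewrite eC; apply: theorem_in_coordinates.
Qed.
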